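(* Let $S=\{(n,i): n\ge 2,\ 1\le i\le k_n\}$ for some natural numbers $k_n$. For each choice of leading terms $$\sum_{\sigma\in\Sigma'_n}\alpha^i_{n,\sigma}\cdot X^{\rho_1}_{\sigma(1)}\cdots X^{\rho_n}_{\sigma(n)}\frac{\partial^{n-2}\Gamma^\omega_{\rho_{n-1}\rho_n}}{\partial x^{\rho_1}\cdots\partial x^{\rho_{n-2}}},\qquad (n,i)\in S,$$ with real constants $\alpha^i_{n,\sigma}$ such that $$\sum_{\sigma\in\Sigma'_n}\alpha^i_{n,\sigma}=0\quad\text{for each }(n,i)\in S,$$ there exist natural differential operators $J^i_n\in\mathfrak{Nat}(\mathrm{Con}\times T^{\otimes n},T)$, $(n,i)\in S$, with local expressions $$J_n^{i,\omega}\left(\Gamma^\lambda_{\mu\nu},X_1^{\delta_1},\ldots,X_n^{\delta_n}\right)=\sum_{\sigma\in\Sigma'_n}\alpha^i_{n,\sigma}\, X^{\rho_1}_{\sigma(1)}\cdots X^{\rho_n}_{\sigma(n)}\frac{\partial^{n-2}\Gamma^\omega_{\rho_{n-1}\rho_n}}{\partial x^{\rho_1}\cdots\partial x^{\rho_{n-2}}}+\text{l.o.t.},$$ where l.o.t. is an expression of differential order $<n-2$, for which all generalized Bianchi–Ricci identities are satisfied without right hand sides; in other words, for each $(n,i)\in S$, every quasi-symmetry $\mathfrak S\in\mathbb R[\Sigma_n]$ of $J^i_n$ is a symmetry of $J^i_n$, i.e. $J^i_n\mathfrak S=0$.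
   Context: **Operators.** $\mathrm{Con}$ is the natural bundle functor of linear (not necessarily torsion-free) connections and $T$ is the tangent bundle functor, on smooth manifolds of a fixed dimension. A connection $\Gamma$ is given locally by Christoffel symbols $\Gamma^\lambda_{\mu\nu}$ without symmetry in $\mu,\nu$. $\mathfrak{Nat}(\mathrm{Con}\times T^{\otimes n},T)$ is the real vector space of natural differential operators acting on a linear connection $\Gamma$ and $n$ vector fields $X_1,\dots,X_n$, linear in each vector field variable, with values in vector fields. Local formulas are written in coordinates $x^\rho$, with summation over repeated indices. $\Sigma'_n$ is the set of permutations $\sigma\in\Sigma_n$ with $\sigma(1)<\cdots<\sigma(n-2)$. **Symmetries and quasi-symmetries.** For an operator $D\in\mathfrak{Nat}(\mathrm{Con}\times T^{\otimes n},T)$ and $\mathfrak S=\sum_{\tau\in\Sigma_n}s_\tau\tau\in\mathbb R[\Sigma_n]$, put $$(D\mathfrak S)(\Gamma,X_1,\dots,X_n)=\sum_\tau s_\tau D(\Gamma,X_{\tau(1)},\dots,X_{\tau(n)}).$$ $\mathfrak S$ is a symmetry of $D$ if $D\mathfrak S=0$. Suppose $D$ has leading term $\sum_{\sigma\in\Sigma_n'}\alpha_\sigma e_\sigma$, where $$e_\sigma=X^{\rho_1}_{\sigma(1)}\cdots X^{\rho_n}_{\sigma(n)}\,\partial^{n-2}\Gamma^\omega_{\rho_{n-1}\rho_n}/\partial x^{\rho_1}\cdots\partial x^{\rho_{n-2}}.$$ The symbols $e_\sigma$, $\sigma\in\Sigma_n$, are regarded as formal symbols subject only to $e_{\sigma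 h}=e_\sigma$ for every $h$ permuting only $\{1,\dots,n-2\}$, so that $\{e_\sigma\}_{\sigma\in\Sigma'_n}$ is a basis of the $\Sigma_n$-module $\mathrm{Ind}^{\Sigma_n}_{\Sigma_{n-2}\times\Sigma_2}(\mathbf 1\otimes\mathbb R[\Sigma_2])$. Then $\mathfrak S$ is a quasi-symmetry of $D$ if it annihilates the leading term, i.e. $\sum_{\tau\in\Sigma_n}\sum_{\sigma\in\Sigma'_n}s_\tau\alpha_\sigma\,e_{\tau\circ\sigma}=0$ in that module. In general, for a quasi-symmetry $\mathfrak S$ of $D$, the operator $D\mathfrak S$ is some operator $\mathfrak D$ of order $\le n-3$ in the connection; the equation $D\mathfrak S=\mathfrak D$ is the corresponding generalized Bianchi–Ricci identity, with right hand side $\mathfrak D$. *)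

(* Defs.v *)
From HB Require Import structures.
From mathcomp Require Import all_boot all_order all_algebra all_fingroup.
From mathcomp Require Import all_classical all_reals all_analysis.

Set Implicit Arguments.
Unset Strict Implicit.
Unset Printing Implicit Defensive.

Import Order.TTheory GRing.Theory Num.Theory.
Import numFieldNormedType.Exports.
Local Open Scope classical_set_scope.
Local Open Scope ring_scope.

Section Calculus.
Variables (R : realType) (N : nat).
Implicit Types f : 'rV[R]_N -> R.

Definition pderiv (i : 'I_N) f : 'rV[R]_N -> R :=
  fun x => 'D_(delta_mx 0 i) f x.

Definition pderivs (s : seq 'I_N) f : 'rV[R]_N -> R := foldr pderiv f s.

(* The functions below are total with unspecified values outside of the open
   set [U]; derivatives at a point of [U] do not see these values. *)
Definition smooth_on (U : set 'rV[R]_N) f : Prop :=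
  forall (s : seq 'I_N) x, U x -> differentiable (pderivs s f) x.

End Calculus.

Section Manifolds.
Variables (R : realType) (d : nat).

Record chart (M : topologicalType) := Chart {
  dom : set M;
  cod : set 'rV[R]_d;
  coord : M -> 'rV[R]_d;
  param : 'rV[R]_d -> M;
  dom_open : open dom;
  cod_open : open cod;
  coord_cod : forall p, dom p -> cod (coord p);
  param_dom : forall x, cod x -> dom (param x);
  coordK : forall p, dom p -> param (coord p) = p;
  paramK : forall x, cod x -> coord (param x) = x;
  coord_continuous : forall p, dom p -> {for p, continuous coord};
  param_continuous : forall x, cod x -> {for x, continuous param} }.

Definition crep (M N : topologicalType) (c : chart M) (c' : chart N)
    (f : M -> N) : 'rV[R]_d -> 'rV[R]_d :=
  fun x => coord c' (f (param c x)).

Definition overlap (M N : topologicalType) (c : chart M) (c' : chart N)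
    (f : M -> N) : set 'rV[R]_d :=
  [set x | cod c x /\ dom c' (f (param c x))].

(* The atlas need not be maximal; two equivalent atlases on the same space are
   identified by [id], which is then a local diffeomorphism. *)
Record manifold := Manifold {
  carrier :> topologicalType;
  idx : Type;
  chart_ : idx -> chart carrier;
  hausdorff_carrier : hausdorff_space carrier;
  second_countable_carrier : @second_countable carrier;
  chart_cover : forall p : carrier, exists c : idx, dom (chart_ c) p;
  chart_compat : forall (c c' : idx) (j : 'I_d),
    smooth_on (overlap (chart_ c) (chart_ c') id)
              (fun x => crep (chart_ c) (chart_ c') id x 0 j) }.

Definition smooth_map_on (M N : manifold) (U : set M) (f : M -> N) : Prop :=
  (forall p, U p -> {for p, continuous f}) /\
  (forall (c : idx M) (c' : idx N) (j : 'I_d),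
     smooth_on (overlap (chart_ c) (chart_ c') f `&`
                [set x | U (param (chart_ c) x)])
               (fun x => crep (chart_ c) (chart_ c') f x 0 j)).

Definition local_diffeo (M N : manifold) (f : M -> N) : Prop :=
  forall p : M, exists (U : set M) (V : set N) (g : N -> M),
    [/\ open U /\ U p, open V,
        (forall q, U q -> V (f q) /\ g (f q) = q),
        (forall q, V q -> U (g q) /\ f (g q) = q) &
        smooth_map_on U f /\ smooth_map_on V g].

(* [X'] at [phi x] is the push-forward of [X] at [x]. *)
Definition vect_transform (phi : 'rV[R]_d -> 'rV[R]_d)
    (X X' : 'rV[R]_d -> 'rV[R]_d) (x : 'rV[R]_d) : Prop :=
  forall a : 'I_d,
    X' (phi x) 0 a = \sum_k pderiv k (fun y => phi y 0 a) x * X x 0 k.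

Definition christoffel := 'rV[R]_d -> 'I_d -> 'I_d -> 'I_d -> R.

(* [G x l m n] is $\Gamma^l_{mn}(x)$, where
   $\nabla_X Y = X^m (\partial_m Y^l + \Gamma^l_{mn} Y^n)\partial_l$.  With
   $y = \phi(x)$ the transformation law, written without inverse matrices, is
   $\frac{\partial y^a}{\partial x^k}\Gamma^k_{ij}
     = \frac{\partial^2 y^a}{\partial x^i\partial x^j}
     + \Gamma'^a_{bc}\frac{\partial y^b}{\partial x^i}
                     \frac{\partial y^c}{\partial x^j}$. *)
Definition conn_transform (phi : 'rV[R]_d -> 'rV[R]_d)
    (G G' : christoffel) (x : 'rV[R]_d) : Prop :=
  let y a := fun z => phi z 0 a in
  forall a i j : 'I_d,
    \sum_k pderiv k (y a) x * G x k i j =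
    pderiv i (pderiv j (y a)) x +
    \sum_b \sum_c G' (phi x) a b c * pderiv i (y b) x * pderiv j (y c) x.

Record vfield (M : manifold) := VField {
  vcomp :> idx M -> 'rV[R]_d -> 'rV[R]_d;
  vcomp_smooth : forall (c : idx M) (k : 'I_d),
    smooth_on (cod (chart_ c)) (fun x => vcomp c x 0 k);
  vcomp_compat : forall (c c' : idx M) x,
    overlap (chart_ c) (chart_ c') id x ->
    vect_transform (crep (chart_ c) (chart_ c') id) (vcomp c) (vcomp c') x }.

Record connection (M : manifold) := Connection {
  ccomp :> idx M -> christoffel;
  ccomp_smooth : forall (c : idx M) (l m n : 'I_d),
    smooth_on (cod (chart_ c)) (fun x => ccomp c x l m n);
  ccomp_compat : forall (c c' : idx M) x,
    overlap (chart_ c) (chart_ c') id x ->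
    conn_transform (crep (chart_ c) (chart_ c') id) (ccomp c) (ccomp c') x }.

Definition vfield_related (M N : manifold) (f : M -> N)
    (X : vfield M) (X' : vfield N) : Prop :=
  forall (c : idx M) (c' : idx N) x, overlap (chart_ c) (chart_ c') f x ->
    vect_transform (crep (chart_ c) (chart_ c') f) (X c) (X' c') x.

Definition conn_related (M N : manifold) (f : M -> N)
    (G : connection M) (G' : connection N) : Prop :=
  forall (c : idx M) (c' : idx N) x, overlap (chart_ c) (chart_ c') f x ->
    conn_transform (crep (chart_ c) (chart_ c') f) (G c) (G' c') x.

End Manifolds.

Section NaturalOperators.
Variables (R : realType) (d n : nat).

(* Coordinates on the jets of order [< r] of a connection and of [n] vector
   fields.  Partial derivatives are indexed by sequences of directions rather
   than by multi-indices, so coordinates of jets are repeated. *)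
Definition jet_idx (r : nat) : finType :=
  ({k : 'I_r & k.-tuple 'I_d} * ('I_d * 'I_d * 'I_d) +
   {k : 'I_r & k.-tuple 'I_d} * ('I_n * 'I_d))%type.

Definition jet_coord (r : nat) (G : christoffel R d)
    (X : 'I_n -> 'rV[R]_d -> 'rV[R]_d) (x : 'rV[R]_d) (t : jet_idx r) : R :=
  match t with
  | inl (s, (l, mu, nu)) => pderivs (tagged s) (fun y => G y l mu nu) x
  | inr (s, (i, l)) => pderivs (tagged s) (fun y => X i y 0 l) x
  end.

Definition jet (r : nat) (G : christoffel R d)
    (X : 'I_n -> 'rV[R]_d -> 'rV[R]_d) (x : 'rV[R]_d) : 'rV[R]_#|jet_idx r| :=
  \row_t jet_coord G X x (enum_val t).

Definition jet_function (r : nat) := 'rV[R]_#|jet_idx r| -> 'rV[R]_d.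

Definition smooth_jet_function (r : nat) (F : jet_function r) : Prop :=
  forall k : 'I_d, smooth_on setT (fun u => F u 0 k).

Definition operator := forall M : manifold R d,
  connection M -> ('I_n -> vfield M) -> vfield M.

Definition multilinear_op (D : operator) : Prop :=
  forall (M : manifold R d) (G : connection M) (X : 'I_n -> vfield M)
    (j : 'I_n) (a : R) (Y Y' Y'' : vfield M),
    (forall c x, cod (chart_ c) x -> Y'' c x = a *: Y c x + Y' c x) ->
    forall c x, cod (chart_ c) x ->
      D M G [eta X with j |-> Y''] c x =
      a *: D M G [eta X with j |-> Y] c x + D M G [eta X with j |-> Y'] c x.

Definition natural_op (D : operator) : Prop :=
  forall (M N : manifold R d) (f : M -> N), local_diffeo f ->
  forall (G : connection M) (G' : connection N)
    (X : 'I_n -> vfield M) (X' : 'I_n -> vfield N),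
    conn_related f G G' -> (forall i, vfield_related f (X i) (X' i)) ->
    vfield_related f (D M G X) (D N G' X').

(* Finite order, with a smooth local expression; by naturality (charts can be
   translated and exchanged) this expression is the same function of the jets in
   every chart and at every point. *)
Definition differential_op (D : operator) : Prop :=
  exists (r : nat) (F : jet_function r), smooth_jet_function F /\
    forall (M : manifold R d) (G : connection M) (X : 'I_n -> vfield M) c x,
      cod (chart_ c) x -> D M G X c x = F (jet r (G c) (fun i => X i c) x).

Record nat_op := NatOp {
  op : operator;
  op_multilinear : multilinear_op op;
  op_natural : natural_op op;
  op_differential : differential_op op }.

Definition symmetry (D : nat_op) (s : {ffun 'S_n -> R}) : Prop :=
  forall (M : manifold R d) (G : connection M) (X : 'I_n -> vfield M) c x,
    cod (chart_ c) x ->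
    \sum_(t : 'S_n) s t *: op D G (fun i => X (t i)) c x = 0.

End NaturalOperators.

Section LeadingTerms.
Variable R : realType.

Definition Sigma' (n : nat) : {set 'S_n} :=
  [set s : 'S_n | [forall i : 'I_n, forall j : 'I_n,
                     (i < j)%N && (j < n - 2)%N ==> (s i < s j)%N]]%SET.

(* Permutations compose from left to right: [(h * s)%g] is $s \circ h$, so the
   right coset below is the class $\{s\circ h\}$ of symbols identified with
   $e_s$; the module is the free one on these classes. *)
Definition e_symbol (n : nat) (s : 'S_n) : {ffun {set 'S_n} -> R^o} :=
  let H := Sym [set i : 'I_n | (i < n - 2)%N]%SET in
  [ffun C => (C == (H :* s)%g)%:R].

(* [(s * t)%g] is $t \circ s$. *)
Definition quasi_symmetry (n : nat) (alpha : 'S_n -> R)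
    (sy : {ffun 'S_n -> R}) : Prop :=
  \sum_(t : 'S_n) \sum_(s in Sigma' n)
    (sy t * alpha s) *: e_symbol (s * t)%g = 0.

(* The number of vector fields is [n = m.+2]; the positions $1,\dots,n$ are [inord 0, ..., inord m.+1]. *)
Definition leading_term (d m : nat) (alpha : 'S_m.+2 -> R)
    (G : christoffel R d) (X : 'I_m.+2 -> 'rV[R]_d -> 'rV[R]_d)
    (x : 'rV[R]_d) : 'rV[R]_d :=
  \row_w \sum_(s in Sigma' m.+2) alpha s *
    \sum_(rho : {ffun 'I_m.+2 -> 'I_d})
      (\prod_(i < m.+2) X (s i) x 0 (rho i)) *
      pderivs [seq rho (inord i) | i <- iota 0 m]
        (fun y => G y w (rho (inord m)) (rho (inord m.+1))) x.

(* The lower order terms involve neither the connection nor the vector fields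
   through derivatives of order [>= m = n - 2]. *)
Definition has_leading_term (d m : nat) (D : nat_op R d m.+2)
    (alpha : 'S_m.+2 -> R) : Prop :=
  exists L : jet_function R d m.+2 m, smooth_jet_function L /\
    forall (M : manifold R d) (G : connection M) (X : 'I_m.+2 -> vfield M) c x,
      cod (chart_ c) x ->
      op D G X c x = leading_term alpha (G c) (fun i => X i c) x +
                    L (jet m (G c) (fun i => X i c) x).

End LeadingTerms.

(* Main.v *)
(** Covariant derivatives of the torsion and of the curvature are natural
    operators with leading terms $e_\sigma-e_{\sigma\circ\tau}$, where $\tau$ is
    the transposition of the positions $(n-1,n)$, respectively $(n-2,n-1)$.
    Together with the permutations of the first $n-2$ positions, which act
    trivially by symmetry of partial derivatives, these transpositions generate
    $\Sigma_n$, so that $e_{\mathrm{id}}-e_\tau$ is a leading term for every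
    $\tau$.  Averaging over $\tau$, and then over the permutations $h$ of the
    first $n-2$ positions, gives a natural operator $D$ with leading term
    $e_{\mathrm{id}}-\frac1{n!}\sum_\tau e_\tau$ for which
    $D_\sigma(\Gamma,X)=D(\Gamma,X_{\sigma(1)},\dots,X_{\sigma(n)})$ depends
    only on the class of $\sigma$, i.e. on $e_\sigma$.  Hence
    $\sum\alpha_\sigma e_\sigma\mapsto\sum\alpha_\sigma D_\sigma$ is well
    defined and $\Sigma_n$-equivariant, so quasi-symmetries are symmetries, and
    the averaged part of the leading term vanishes when $\sum\alpha_\sigma=0$. *)

Require Import Defs.
From HB Require Import structures.
From mathcomp Require Import all_boot all_order all_algebra all_fingroup.
From mathcomp Require Import all_classical all_reals all_analysis.
From mathcomp Require Import ring lra.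

Set Implicit Arguments.
Unset Strict Implicit.
Unset Printing Implicit Defensive.

Import Order.TTheory GRing.Theory Num.Theory.
Import numFieldNormedType.Exports.
Local Open Scope classical_set_scope.
Local Open Scope ring_scope.

(** * Partial derivatives *)

(** The difference [g - f] vanishes near [x], so it is differentiable there with zero differential,
    and [g] is its sum with [f]. *)
Lemma differentiable_near (R : realType) (V W : normedModType R) (f g : V -> W)
    (x : V) : (\forall y \near x, f y = g y) -> differentiable f x -> differentiable g x.
Proof.
move=> fg df; rewrite -[g](addrNK f).
apply: differentiableD => //.
have E : (g - f) \o shift x = cst ((g - f) x) + \0 +o_0 id.
  apply/eqaddoP => e e0; near=> h => /=.
  rewrite !fctE /= (nbhs_singleton fg) subrr !addr0 subr0.
  suff -> : f (h + x) = g (h + x) by rewrite subrr normr0 mulr_ge0// ltW.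
  near: h.
  by have := fg; rewrite (near_shift 0) subr0.
have c0 : continuous (\0 : V -> W) by move=> ?; exact: cvg_cst.
apply/diff_locallyP; rewrite (diff_unique c0 E).
by split.
Unshelve. all: by end_near. Qed.

Section PartialDerivatives.
Variables (R : realType) (N : nat).
Implicit Types (f g : 'rV[R]_N -> R) (x : 'rV[R]_N) (U : set 'rV[R]_N).

Lemma pderiv_near f g x i :
  (\forall y \near x, f y = g y) -> pderiv i f x = pderiv i g x.
Proof. exact: near_eq_derive. Qed.

Lemma pderivD f g x i : differentiable f x -> differentiable g x ->
  pderiv i (fun y => f y + g y) x = pderiv i f x + pderiv i g x.
Proof. by move=> df dg; rewrite /pderiv -deriveD//; exact: diff_derivable. Qed.

Lemma pderivM f g x i : differentiable f x -> differentiable g x ->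
  pderiv i (fun y => f y * g y) x = pderiv i f x * g x + f x * pderiv i g x.
Proof.
move=> df dg; rewrite /pderiv [LHS]deriveM; [|exact: diff_derivable..].
by rewrite addrC /GRing.scale/= [g x * _]mulrC.
Qed.

Lemma pderiv_cst (a : R) x i : pderiv i (fun=> a) x = 0.
Proof. exact: derive_cst. Qed.

Lemma differentiable_mul f g x : differentiable f x -> differentiable g x ->
  differentiable (fun y => f y * g y) x.
Proof. exact: differentiableM. Qed.

Lemma differentiable_add f g x : differentiable f x -> differentiable g x ->
  differentiable (fun y => f y + g y) x.
Proof. exact: differentiableD. Qed.

Lemma differentiable_big_sum (I : Type) (r : seq I) (P : pred I)
    (F : I -> 'rV[R]_N -> R) x :
  (forall k, differentiable (F k) x) ->
  differentiable (fun y => \sum_(k <- r | P k) F k y) x.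
Proof.
move=> dF; elim: r => [|k r IH].
  by under eq_fun do rewrite big_nil; exact: differentiable_cst.
under eq_fun do rewrite big_cons; case: (P k) => //.
exact: differentiable_add.
Qed.

Lemma differentiable_big_prod (I : Type) (r : seq I) (P : pred I)
    (F : I -> 'rV[R]_N -> R) x :
  (forall k, differentiable (F k) x) ->
  differentiable (fun y => \prod_(k <- r | P k) F k y) x.
Proof.
move=> dF; elim: r => [|k r IH].
  by under eq_fun do rewrite big_nil; exact: differentiable_cst.
under eq_fun do rewrite big_cons; case: (P k) => //.
exact: differentiable_mul.
Qed.

Lemma pderiv_sum (I : Type) (r : seq I) (P : pred I)
    (F : I -> 'rV[R]_N -> R) x i :
  (forall k, differentiable (F k) x) ->
  pderiv i (fun y => \sum_(k <- r | P k) F k y) x =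
  \sum_(k <- r | P k) pderiv i (F k) x.
Proof.
move=> dF; elim: r => [|k r IH].
  by under eq_fun do rewrite big_nil; rewrite pderiv_cst big_nil.
under eq_fun do rewrite big_cons; rewrite big_cons; case: (P k) => //.
by rewrite pderivD ?IH//; exact: differentiable_big_sum.
Qed.

Lemma pderiv_prod (I : finType) (F : I -> 'rV[R]_N -> R) x i :
  (forall k, differentiable (F k) x) ->
  pderiv i (fun y => \prod_k F k y) x =
  \sum_p \prod_k (if k == p then pderiv i (F k) x else F k x).
Proof.
move=> dF.
suff H (r : seq I) : uniq r -> pderiv i (fun y => \prod_(k <- r) F k y) x =
  \sum_(p <- r) \prod_(k <- r) (if k == p then pderiv i (F k) x else F k x).
  by rewrite H// index_enum_uniq.
elim: r => [|k r IH] /=.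
  by under eq_fun do rewrite big_nil; rewrite pderiv_cst big_nil.
move=> /andP[kr ur]; under eq_fun do rewrite big_cons.
rewrite pderivM//; last exact: differentiable_big_prod.
rewrite big_cons big_cons eqxx IH//; congr (_ * _ + _).
  apply: eq_big_seq => j jr; case: eqP => // jk.
  by move: kr; rewrite -jk jr.
rewrite big_distrr /=; apply: eq_big_seq => j jr; rewrite big_cons.
case: eqP => // kj; by move: kr; rewrite kj jr.
Qed.

Lemma differentiable_row M (phi : 'rV[R]_N -> 'rV[R]_M) x :
  (forall a, differentiable (fun y => phi y 0 a) x) -> differentiable phi x.
Proof.
move=> dphi; rewrite (_ : phi = \sum_(a < M) (fun y => phi y 0 a *: delta_mx 0 a)).
  apply: differentiable_sum => a.
  exact: differentiableZl.
apply/funext => y; rewrite fct_sumE; exact: row_sum_delta.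
Qed.

Lemma smooth_diff U f x : smooth_on U f -> U x -> differentiable f x.
Proof. by move=> /(_ [::]); exact. Qed.

Lemma pderivs_rcons s i f : pderivs (rcons s i) f = pderivs s (pderiv i f).
Proof. by rewrite /pderivs foldr_rcons. Qed.

Lemma smooth_pderiv U f i : smooth_on U f -> smooth_on U (pderiv i f).
Proof. by move=> sf s x Ux; rewrite -pderivs_rcons; exact: sf. Qed.

Lemma smooth_on_pderivs U f s : smooth_on U f -> smooth_on U (pderivs s f).
Proof. by move=> sf; elim: s => //= i s; exact: smooth_pderiv. Qed.

Lemma pderiv_open U f g i x : open U -> (forall y, U y -> f y = g y) -> U x ->
  pderiv i f x = pderiv i g x.
Proof.
move=> oU fg Ux; apply: pderiv_near.
by near=> y; apply: fg; near: y; exact: open_nbhs_nbhs.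
Unshelve. all: by end_near. Qed.

(** Coinduction: every iterated derivative of [f] agrees on [U] with a member of [C], and on an open
    set this agreement transfers differentiability. No closed formula for iterated derivatives is
    required. *)
Lemma smooth_coind U (C : ('rV[R]_N -> R) -> Prop) : open U ->
  (forall g, C g -> forall x, U x -> differentiable g x) ->
  (forall g i, C g -> exists2 h, C h & forall x, U x -> pderiv i g x = h x) ->
  forall f, C f -> smooth_on U f.
Proof.
move=> oU Cd CD f Cf s x Ux.
have [h Ch Eh] : exists2 h, C h & forall x, U x -> pderivs s f x = h x.
  elim: s => [|i s [h Ch Eh]]; first by exists f.
  have [h' Ch' Eh'] := CD h i Ch; exists h' => // y Uy /=.
  by rewrite -Eh'//; exact: (pderiv_open _ oU).
apply: (differentiable_near (f := h)); last exact: Cd.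
near=> y; apply/esym/Eh; near: y; exact: open_nbhs_nbhs.
Unshelve. all: by end_near. Qed.

(** Products alone are not stable under differentiation, so coinduction is run on the whole algebra
    generated by the smooth functions, which the Leibniz rule preserves. *)
Inductive smooth_algebra U : ('rV[R]_N -> R) -> Prop :=
| SmoothBase f : smooth_on U f -> smooth_algebra U f
| SmoothCst a : smooth_algebra U (fun=> a)
| SmoothAdd f g : smooth_algebra U f -> smooth_algebra U g ->
    smooth_algebra U (fun x => f x + g x)
| SmoothMul f g : smooth_algebra U f -> smooth_algebra U g ->
    smooth_algebra U (fun x => f x * g x).

Lemma smooth_algebraP U f : open U -> smooth_algebra U f -> smooth_on U f.
Proof.
move=> oU; apply: (smooth_coind oU) => {f} f.
  elim=> [{}f sf|a|{}f g _ sf _ sg|{}f g _ sf _ sg] x Ux.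
  - exact: smooth_diff sf Ux.
  - exact: differentiable_cst.
  - by apply: differentiable_add; [exact: sf|exact: sg].
  - by apply: differentiable_mul; [exact: sf|exact: sg].
move=> i Cf.
(* Differentiability is carried along in the induction because the sum and product rules ask for
   it. *)
suff [h [Ch _ Eh]] : exists h, [/\ smooth_algebra U h,
    forall x, U x -> differentiable f x &
    forall x, U x -> pderiv i f x = h x] by exists h.
elim: Cf => [{}f sf|a|{}f g Cf [h [Ch df Eh]] Cg [k [Ck dg Ek]]
            |{}f g Cf [h [Ch df Eh]] Cg [k [Ck dg Ek]]].
- exists (pderiv i f); split => //.
    by apply: SmoothBase; exact: smooth_pderiv.
  by move=> x Ux; exact: smooth_diff sf Ux.
- exists (fun=> 0); split; [exact: SmoothCst| |].
    by move=> x Ux; exact: differentiable_cst.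
  by move=> x Ux; exact: pderiv_cst.
- exists (fun x => h x + k x); split; first exact: SmoothAdd.
    by move=> x Ux; apply: differentiable_add; [exact: df|exact: dg].
  by move=> x Ux; rewrite pderivD ?Eh ?Ek//; [exact: df|exact: dg].
- exists (fun x => h x * g x + f x * k x); split.
  + by apply: SmoothAdd; apply: SmoothMul.
  + by move=> x Ux; apply: differentiable_mul; [exact: df|exact: dg].
  + by move=> x Ux; rewrite pderivM ?Eh ?Ek//; [exact: df|exact: dg].
Qed.

Lemma smoothD U f g : open U -> smooth_on U f -> smooth_on U g ->
  smooth_on U (fun x => f x + g x).
Proof.
by move=> oU sf sg; apply: smooth_algebraP => //; apply: SmoothAdd; exact: SmoothBase.
Qed.

Lemma smoothM U f g : open U -> smooth_on U f -> smooth_on U g ->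
  smooth_on U (fun x => f x * g x).
Proof.
by move=> oU sf sg; apply: smooth_algebraP => //; apply: SmoothMul; exact: SmoothBase.
Qed.

Lemma smooth_cst U a : open U -> smooth_on U (fun=> a).
Proof. by move=> oU; apply: smooth_algebraP => //; exact: SmoothCst. Qed.

Lemma smooth_sum U (I : Type) (r : seq I) (P : pred I)
    (F : I -> 'rV[R]_N -> R) : open U -> (forall k, smooth_on U (F k)) ->
  smooth_on U (fun y => \sum_(k <- r | P k) F k y).
Proof.
move=> oU sF; elim: r => [|k r IH].
  by under eq_fun do rewrite big_nil; exact: smooth_cst.
under eq_fun do rewrite big_cons; case: (P k) => //.
exact: smoothD.
Qed.

Lemma smooth_prod U (I : Type) (r : seq I) (P : pred I)
    (F : I -> 'rV[R]_N -> R) : open U -> (forall k, smooth_on U (F k)) ->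
  smooth_on U (fun y => \prod_(k <- r | P k) F k y).
Proof.
move=> oU sF; elim: r => [|k r IH].
  by under eq_fun do rewrite big_nil; exact: smooth_cst.
under eq_fun do rewrite big_cons; case: (P k) => //.
exact: smoothM.
Qed.

Lemma smooth_coord U (i : 'I_N) : open U -> smooth_on U (fun x => x 0 i).
Proof.
move=> oU; pose C (g : 'rV[R]_N -> R) := g = (fun x => x 0 i) \/ exists a, g = fun=> a.
apply: (@smooth_coind _ C) => //; last by left.
- move=> g [->|[a ->]] x _; [exact: differentiable_coord|exact: differentiable_cst].
- move=> g j [->|[a ->]]; last first.
    by exists (fun=> 0); [right; exists 0|move=> x _; exact: pderiv_cst].
  exists (fun=> (delta_mx 0 j : 'rV[R]_N) 0 i); first by right; eexists.
  move=> x _; rewrite /pderiv deriveE; last exact: differentiable_coord.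
  pose f : 'rV[R]_N -> R := fun x => x 0 i.
  have lf : linear f by move=> a u v; rewrite /f !mxE.
  pose fl : {linear 'rV[R]_N -> R} := HB.pack f (GRing.isLinear.Build _ _ _ _ f lf).
  have cf : continuous fl by exact: coord_continuous.
  change ('d fl x (delta_mx 0 j) = fl (delta_mx 0 j)).
  by rewrite (diff_lin x cf).
Qed.

(** The second difference is $\psi(h)-\psi(0)$ with $\psi(t)=f(x+tu+hv)-f(x+tu)$. The mean value
    theorem turns it into $h$ times a difference of two values of $g=D_uf$, and differentiability of
    $g$ at the single point $x$ estimates both. *)
Lemma mixed_difference U f x (u v : 'rV[R]_N) : open U -> U x ->
  (forall y, U y -> differentiable f y) -> differentiable ('D_u f) x ->
  forall e : R, 0 < e -> \forall h \near 0^'+,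
    `|f (x + h *: u + h *: v) - f (x + h *: u) - f (x + h *: v) + f x
      - h ^+ 2 * 'D_v ('D_u f) x| <= e * h ^+ 2.
Proof.
move=> oU Ux df; set g := 'D_u f => dg e e0.
(* The two errors add up to at most $2(e/n)h(|u|+|v|)$, which this [n] bounds by $eh$; the summand 1
   keeps [n] positive when [u] and [v] vanish. *)
have [n n0 nE] : exists2 n : R, 0 < n & n = 2 * (`|u| + `|v|) + 1.
  by eexists; [|reflexivity]; rewrite ltr_wpDl// mulr_ge0// addr_ge0.
have en0 : 0 < e / n by rewrite divr_gt0.
pose P (w : 'rV[R]_N) := U (x + w) /\ `|g (x + w) - g x - 'd g x w| <= e / n * `|w|.
have [r r0 Hr] : exists2 r : R, 0 < r & forall w : 'rV[R]_N, `|w| < r -> P w.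
  have /eqaddoP/(_ _ en0) H1 := funext (diff_locallyxC dg).
  have H2 : \forall w \near (0 : 'rV[R]_N), U (x + w).
    have : \forall y \near x, U y by exact: open_nbhs_nbhs.
    rewrite (near_shift 0) subr0.
    by apply: filterS => w /=; rewrite addrC.
  have : \forall w \near (0 : 'rV[R]_N), P w.
    apply: filterS2 H2 H1 => w Uw.
    by rewrite !fctE /= opprD addrA; split.
  move/nbhs_normP => [r /= r0 Hr].
  by exists r => // w wr; apply: Hr; rewrite /ball_ /= sub0r normrN.
near=> h.
have h0 : 0 < h by near: h; exact: nbhs_right_gt.
have hr : h * (`|u| + `|v|) < r.
  near: h; exists (r / n) => /=; first by rewrite divr_gt0.
  move=> h /=; rewrite sub0r normrN => hrn h0.
  rewrite gtr0_norm// ltr_pdivlMr// in hrn; apply: le_lt_trans hrn.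
  rewrite ler_pM2l// nE.
  have := normr_ge0 u; have := normr_ge0 v; lra.
have small (s t : R) : 0 <= s <= h -> 0 <= t <= h ->
    `|s *: u + t *: v| <= h * (`|u| + `|v|).
  move=> /andP[s0 sh] /andP[t0 th]; apply: (le_trans (ler_normD _ _)).
  by rewrite !normrZ !ger0_norm// mulrDr lerD// ler_wpM2r.
have Us (s t : R) : 0 <= s <= h -> 0 <= t <= h -> U (x + (s *: u + t *: v)).
  by move=> hs ht; apply: (proj1 (Hr _ _)); exact: le_lt_trans (small s t hs ht) hr.
have hh : 0 <= h <= h by rewrite ltW/=.
have zh : 0 <= (0 : R) <= h by rewrite lexx ltW.
(* Keeping [0 *: v] makes both terms instances of [dline], at [t = h] and at [t = 0]. *)
pose psi (t : R) := f (x + (t *: u + h *: v)) - f (x + (t *: u + 0 *: v)).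
have dline (s t : R) : 0 <= s <= h -> 0 <= t <= h ->
    is_derive s 1 (fun s : R => f (x + (s *: u + t *: v))) (g (x + (s *: u + t *: v))).
  move=> hs ht; have Ust := Us _ _ hs ht.
  have dfu := @diff_derivable _ _ _ f _ u (df _ Ust).
  have E : (fun k : R => k^-1 *: (f (x + ((k *: (1 : R) + s) *: u + t *: v))
                                - f (x + (s *: u + t *: v)))) =
      (fun k : R => k^-1 *: (f (k *: u + (x + (s *: u + t *: v)))
                                - f (x + (s *: u + t *: v)))).
    apply/funext => k; congr (_ *: (f _ - _)).
    have -> : k *: (1 : R) = k by exact: mulr1.
    by rewrite scalerDl -(addrA (k *: u)) [RHS]addrCA.
  by apply: DeriveDef; rewrite /derivable /derive /g /derive /= E.
have dpsi (s : R) : 0 <= s <= h ->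
    is_derive s 1 psi (g (x + (s *: u + h *: v)) - g (x + (s *: u + 0 *: v))).
  by move=> hs; apply: is_deriveB; exact: dline.
have sub (s : R) : s \in `]0, h[%R -> 0 <= s <= h.
  by rewrite in_itv/= => /andP[s0 sh]; rewrite !ltW.
have [||c /sub ch Ec] := @MVT R psi
    (fun s => g (x + (s *: u + h *: v)) - g (x + (s *: u + 0 *: v))) 0 h h0.
- by move=> s /sub; exact: dpsi.
- apply: derivable_within_continuous => s.
  by rewrite in_itv/= => hs; case: (dpsi s hs).
have := Hr _ (le_lt_trans (small c h ch hh) hr).
have := Hr _ (le_lt_trans (small c 0 ch zh) hr).
have := small c h ch hh; have := small c 0 ch zh.
move: Ec; rewrite /psi !scale0r !addr0 !add0r subr0 addrA.
set w1 := c *: u + h *: v; set w2 := c *: u.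
have Ed : 'd g x w1 = 'd g x w2 + h * 'D_v g x.
  by rewrite deriveE// /w1 linearD [X in _ + X]linearZ.
move=> Ec n2 n1 [_ H2] [_]; rewrite Ed => H1.
rewrite [X in `|X|](_ : _ = h * ((g (x + w1) - g x - ('d g x w2 + h * 'D_v g x))
    - (g (x + w2) - g x - 'd g x w2))); last first.
  transitivity ((g (x + w1) - g (x + w2)) * h - h ^+ 2 * 'D_v g x); last by ring.
  by rewrite -Ec; ring.
rewrite normrM gtr0_norm// expr2 mulrCA ler_pM2l//.
apply: (le_trans (ler_normB _ _)).
apply: (le_trans (lerD H1 H2)).
rewrite -mulrDr mulrAC ler_pdivrMr// -mulrA ler_pM2l//.
apply: (le_trans (lerD n1 n2)).
rewrite -mulr2n -mulrnAr ler_pM2l// nE mulr2n.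
have := normr_ge0 u; have := normr_ge0 v; lra.
Unshelve. all: by end_near. Qed.

(** The second difference is symmetric in the two directions and, divided by $h^2$ for small $h$, is
    within [e / 2] of either mixed derivative. *)
Lemma pderivC U f x i j : open U -> smooth_on U f -> U x ->
  pderiv i (pderiv j f) x = pderiv j (pderiv i f) x.
Proof.
move=> oU sf Ux; apply/eqP; rewrite -subr_eq0 -normr_le0.
apply/ler_addgt0Pr => e e0; rewrite add0r.
have e2 : 0 < e / 2 by rewrite divr_gt0.
have df y : U y -> differentiable f y by exact: smooth_diff.
have dpf k : differentiable (pderiv k f) x.
  by apply: smooth_diff Ux; exact: smooth_pderiv.
have M k l : \forall h \near (0 : R)^'+,
    `|f (x + h *: delta_mx 0 k + h *: delta_mx 0 l) - f (x + h *: delta_mx 0 k)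
      - f (x + h *: delta_mx 0 l) + f x
      - h ^+ 2 * pderiv l (pderiv k f) x| <= e / 2 * h ^+ 2.
  have := @mixed_difference U f x (delta_mx 0 k) (delta_mx 0 l) oU Ux df (dpf k) _ e2.
  by apply: filterS => h; exact.
have [h [h0 [H1 H2]]] := filter_ex (filterI (nbhs_right_gt (0 : R)) (filterI (M j i) (M i j))).
move: H1 H2.
rewrite [X in f X](_ : _ = x + h *: delta_mx 0 i + h *: delta_mx 0 j); last first.
  by rewrite addrAC.
set a := f _; set b := f (_ + _); set c := f (_ + _); set A := pderiv i _ x.
set B := pderiv j _ x => H1 H2.
have h2 : 0 < h ^+ 2 by rewrite exprn_gt0.
rewrite -(ler_pM2r h2) -[h ^+ 2 in X in X <= _](ger0_norm (ltW h2)) -normrM.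
rewrite [X in `|X|](_ : _ = (a - c - b + f x - h ^+ 2 * B) -
  (a - b - c + f x - h ^+ 2 * A)); last by ring.
apply: (le_trans (ler_normB _ _)).
apply: (le_trans (lerD H2 H1)).
by rewrite -mulrDl -splitr.
Qed.

End PartialDerivatives.

Lemma pderiv_comp (R : realType) (M N : nat) (f : 'rV[R]_N -> R)
    (phi : 'rV[R]_M -> 'rV[R]_N) (x : 'rV[R]_M) (i : 'I_M) :
  (forall a, differentiable (fun y => phi y 0 a) x) -> differentiable f (phi x) ->
  pderiv i (fun y => f (phi y)) x =
  \sum_a pderiv a f (phi x) * pderiv i (fun y => phi y 0 a) x.
Proof.
move=> dphi df; have dp := differentiable_row dphi.
rewrite /pderiv deriveE; last exact: differentiable_comp.
rewrite [X in 'd X _](_ : _ = f \o phi)// diff_comp//=.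
rewrite -(deriveE _ dp) [X in 'd _ _ X](row_sum_delta) [LHS]linear_sum.
apply: eq_bigr => a _; rewrite [LHS]linearZ /= -(deriveE _ df) mulrC; congr (_ * _).
by rewrite derive_mx ?mxE//; exact: diff_derivable.
Qed.

(** * Polynomials in the jets of a connection *)

Section JetExpressions.
Variables (R : realType) (d : nat).

(* Polynomials without constant term in the partial derivatives of the
   Christoffel symbols; [JVar s l m n] stands for
   $\partial_{s_0}\partial_{s_1}\cdots\Gamma^l_{mn}$.  Excluding constants makes
   an expression of order [< 0] vanish. *)
Inductive jexp : Type :=
| JZero
| JVar of seq 'I_d & 'I_d & 'I_d & 'I_d
| JAdd of jexp & jexp
| JMul of jexp & jexp
| JScale of R & jexp.

Definition jval := seq 'I_d -> 'I_d -> 'I_d -> 'I_d -> R.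

Fixpoint jeval (v : jval) (e : jexp) : R :=
  match e with
  | JZero => 0
  | JVar s l m n => v s l m n
  | JAdd e f => jeval v e + jeval v f
  | JMul e f => jeval v e * jeval v f
  | JScale a e => a * jeval v e
  end.

Fixpoint jder (i : 'I_d) (e : jexp) : jexp :=
  match e with
  | JZero => JZero
  | JVar s l m n => JVar (i :: s) l m n
  | JAdd e f => JAdd (jder i e) (jder i f)
  | JMul e f => JAdd (JMul (jder i e) f) (JMul e (jder i f))
  | JScale a e => JScale a (jder i e)
  end.

Fixpoint jorder_lt (r : nat) (e : jexp) : bool :=
  match e with
  | JZero => true
  | JVar s _ _ _ => (size s < r)%N
  | JAdd e f | JMul e f => jorder_lt r e && jorder_lt r f
  | JScale _ e => jorder_lt r e
  end.

Lemma jorder_ltW r r' e : (r <= r')%N -> jorder_lt r e -> jorder_lt r' e.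
Proof.
move=> rr'; elim: e => //=.
- by move=> s _ _ _ /leq_trans; apply.
- by move=> e IHe f IHf /andP[/IHe-> /IHf->].
- by move=> e IHe f IHf /andP[/IHe-> /IHf->].
Qed.

Lemma jorder_lt_jder r i e : jorder_lt r e -> jorder_lt r.+1 (jder i e).
Proof.
elim: e => //=.
- by move=> e IHe f IHf /andP[/IHe-> /IHf->].
- move=> e IHe f IHf /andP[re rf].
  by rewrite IHe// IHf// !(jorder_ltW (leqnSn r)).
Qed.

Lemma jeval_eq r (v v' : jval) e :
  (forall s l m n, (size s < r)%N -> v s l m n = v' s l m n) ->
  jorder_lt r e -> jeval v e = jeval v' e.
Proof.
move=> vv'; elim: e => //=.
- by move=> e IHe f IHf /andP[/IHe-> /IHf->].
- by move=> e IHe f IHf /andP[/IHe-> /IHf->].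
- by move=> a e IHe /IHe->.
Qed.

Lemma jeval_order0 v e : jorder_lt 0 e -> jeval v e = 0.
Proof.
elim: e => //=.
- by move=> e IHe f IHf /andP[/IHe-> /IHf->]; rewrite addr0.
- by move=> e IHe f IHf /andP[/IHe-> _]; rewrite mul0r.
- by move=> a e IHe /IHe->; rewrite mulr0.
Qed.

Definition jsum (I : Type) (r : seq I) (F : I -> jexp) : jexp :=
  \big[JAdd/JZero]_(i <- r) F i.

Lemma jeval_sum (I : Type) (r : seq I) (F : I -> jexp) v :
  jeval v (jsum r F) = \sum_(i <- r) jeval v (F i).
Proof. exact: big_morph. Qed.

Lemma jorder_lt_sum (I : Type) (r : seq I) (F : I -> jexp) k :
  (forall i, jorder_lt k (F i)) -> jorder_lt k (jsum r F).
Proof.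
by move=> FP; rewrite /jsum; elim/big_rec: _ => //= i e _ ->; rewrite FP.
Qed.

Definition cjet (G : christoffel R d) (x : 'rV[R]_d) : jval :=
  fun s l m n => pderivs s (fun y => G y l m n) x.

Definition smooth_conn (U : set 'rV[R]_d) (G : christoffel R d) : Prop :=
  forall l m n, smooth_on U (fun y => G y l m n).

Definition smooth_vf (U : set 'rV[R]_d) (X : 'rV[R]_d -> 'rV[R]_d) : Prop :=
  forall k, smooth_on U (fun y => X y 0 k).

Lemma jeval_smooth U G e : open U -> smooth_conn U G ->
  smooth_on U (fun x => jeval (cjet G x) e).
Proof.
move=> oU sG; elim: e => /=.
- exact: smooth_cst.
- by move=> s l m n; apply: smooth_on_pderivs.
- by move=> e se f sf; apply: smoothD.
- by move=> e se f sf; apply: smoothM.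
- by move=> a e se; apply: smoothM => //; exact: smooth_cst.
Qed.

Lemma pderiv_jeval U G e x i : open U -> smooth_conn U G -> U x ->
  pderiv i (fun y => jeval (cjet G y) e) x = jeval (cjet G x) (jder i e).
Proof.
move=> oU sG Ux.
have df e' : differentiable (fun y => jeval (cjet G y) e') x.
  exact: smooth_diff (jeval_smooth e' oU sG) Ux.
elim: e => //=.
- exact: pderiv_cst.
- by move=> e IHe f IHf; rewrite pderivD ?IHe ?IHf.
- by move=> e IHe f IHf; rewrite pderivM ?IHe ?IHf.
- by move=> a e IHe; rewrite pderivM ?IHe// ?pderiv_cst ?mul0r ?add0r.
Qed.

End JetExpressions.

(** * Contractions of tensors with vectors *)

Section Slots.
Variables (R : comRingType) (d n : nat).
Implicit Types (A : {ffun 'I_n -> 'I_d} -> R) (v : 'I_n -> 'I_d -> R).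

Definition upd (T : Type) (v : 'I_n -> T) (p : 'I_n) (t : T) : 'I_n -> T :=
  fun q => if q == p then t else v q.

Definition contr A v : R := \sum_(rho : {ffun 'I_n -> 'I_d}) (\prod_i v i (rho i)) * A rho.

Lemma contr_slotE A v p u :
  contr A (upd v p u) =
  \sum_(rho : {ffun 'I_n -> 'I_d}) u (rho p) * ((\prod_(i | i != p) v i (rho i)) * A rho).
Proof.
apply: eq_bigr => rho _; rewrite (bigD1 p)//= /upd eqxx mulrA; congr (_ * _ * _).
by apply: eq_bigr => i /negPf->.
Qed.

Lemma contr_slotD A v p u u' :
  contr A (upd v p (fun j => u j + u' j)) =
  contr A (upd v p u) + contr A (upd v p u').
Proof.
by rewrite !contr_slotE -big_split; apply: eq_bigr => rho _; rewrite mulrDl.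
Qed.

Lemma contr_slot_sum A v p (I : finType) (a : I -> R) (u : I -> 'I_d -> R) :
  contr A (upd v p (fun j => \sum_m a m * u m j)) =
  \sum_m a m * contr A (upd v p (u m)).
Proof.
rewrite contr_slotE; under [RHS]eq_bigr do rewrite contr_slotE big_distrr.
rewrite exchange_big; apply: eq_bigr => rho _; rewrite big_distrl /=.
by apply: eq_bigr => m _; rewrite -mulrA.
Qed.

(* Exchanging the summation index with the [p]-th tensor index is an involution. *)
Lemma contr_slot_mx A v p (M : 'I_d -> 'I_d -> R) :
  contr A (upd v p (fun j => \sum_l M j l * v p l)) =
  contr (fun rho => \sum_j M j (rho p) * A (finfun (upd rho p j))) v.
Proof.
rewrite contr_slotE; under eq_bigr do rewrite big_distrl.
under [RHS]eq_bigr do rewrite big_distrr.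
rewrite !pair_bigA /=.
pose h (q : {ffun 'I_n -> 'I_d} * 'I_d) : {ffun 'I_n -> 'I_d} * 'I_d :=
  (finfun (upd q.1 p q.2), q.1 p).
have hK : involutive h.
  move=> [rho l]; rewrite /h /= ffunE /upd eqxx; congr (_, _).
  by apply/ffunP => q; rewrite ffunE; case: eqP => [->//|]; rewrite ffunE; case: eqP.
rewrite (reindex_inj (inv_inj hK)); apply: eq_bigr => -[rho j] _ /=.
rewrite ffunE {1}/upd eqxx [in RHS](bigD1 p)//= (eq_bigr (fun i => v i (rho i))).
  by ring.
by move=> i /negPf ip; rewrite ffunE /upd ip.
Qed.

End Slots.

Section ConsIndex.
Variables (V : nmodType) (d n : nat).

Definition fcons (m : 'I_d) (rho : {ffun 'I_n -> 'I_d}) : {ffun 'I_n.+1 -> 'I_d} :=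
  [ffun q => if unlift ord0 q is Some q' then rho q' else m].

Definition ftail (rho : {ffun 'I_n.+1 -> 'I_d}) : {ffun 'I_n -> 'I_d} :=
  [ffun q => rho (lift ord0 q)].

Lemma fcons0 m rho : fcons m rho ord0 = m.
Proof. by rewrite ffunE unlift_none. Qed.

Lemma fconsS m rho q : fcons m rho (lift ord0 q) = rho q.
Proof. by rewrite ffunE liftK. Qed.

Lemma ftail_fcons m rho : ftail (fcons m rho) = rho.
Proof. by apply/ffunP => q; rewrite ffunE fconsS. Qed.

Lemma sum_fcons (F : {ffun 'I_n.+1 -> 'I_d} -> V) :
  \sum_rho F rho = \sum_m \sum_rho F (fcons m rho).
Proof.
rewrite pair_bigA /=.
rewrite (reindex (fun q : 'I_d * {ffun 'I_n -> 'I_d} => fcons q.1 q.2))//.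
exists (fun rho : {ffun 'I_n.+1 -> 'I_d} => (rho ord0, ftail rho)) => [[m rho] _|rho _] /=.
  by rewrite fcons0 ftail_fcons.
apply/ffunP => q; rewrite ffunE; case: unliftP => [q' ->|->//].
by rewrite ffunE.
Qed.

End ConsIndex.

(** * Covariant derivatives of tensors *)

Section CovariantDerivative.
Variables (R : realType) (d : nat).
Local Notation vf := ('rV[R]_d -> 'rV[R]_d).
Implicit Types (G : christoffel R d) (U W : set 'rV[R]_d) (x : 'rV[R]_d).

(** Components $c^w_\rho$ with [n] lower indices and one upper index; being polynomials in the jet
    of the connection, they serve all connections at once. *)
Definition tensor (n : nat) := {ffun 'I_n -> 'I_d} -> 'I_d -> jexp R d.

Definition tapply n (c : tensor n) G (X : 'I_n -> vf) : vf :=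
  fun x => \row_w contr (fun rho => jeval (cjet G x) (c rho w)) (fun i j => X i x 0 j).

Definition nabla G (X Y : vf) : vf :=
  fun x => \row_w \sum_m X x 0 m *
    (pderiv m (fun y => Y y 0 w) x + \sum_l G x w m l * Y x 0 l).

(** With $m=\rho_0$ these are the classical components
    $\partial_mc^w+\Gamma^w_{ml}c^l-\sum_p\Gamma^l_{m\rho_p}c^w_{\ldots l\ldots}$, where $p$ runs
    over the slots of the tail; the direction of differentiation becomes the first slot. *)
Definition nabla_tensor n (c : tensor n) : tensor n.+1 :=
  fun rho w =>
    let m := rho ord0 in
    JAdd (jder m (c (ftail rho) w))
      (JAdd (jsum (enum 'I_d) (fun l => JMul (JVar R [::] w m l) (c (ftail rho) l)))
        (JScale (-1) (jsum (enum 'I_n) (fun p => jsum (enum 'I_d) (fun l =>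
          JMul (JVar R [::] l m (ftail rho p))
               (c (finfun (upd (ftail rho) p l)) w)))))).

Lemma tapply_smooth n (c : tensor n) U G X : open U -> smooth_conn U G ->
  (forall i, smooth_vf U (X i)) -> smooth_vf U (tapply c G X).
Proof.
move=> oU sG sX w; rewrite /tapply; under eq_fun do rewrite mxE.
apply: smooth_sum => // rho; apply: smoothM => //; last exact: jeval_smooth.
by apply: smooth_prod => // i; exact: sX.
Qed.

Lemma nabla_smooth U G X Y : open U -> smooth_conn U G ->
  smooth_vf U X -> smooth_vf U Y -> smooth_vf U (nabla G X Y).
Proof.
move=> oU sG sX sY w; rewrite /nabla; under eq_fun do rewrite mxE.
apply: smooth_sum => // m; apply: smoothM => //.
apply: smoothD => //; first by apply: smooth_pderiv.
by apply: smooth_sum => // l; apply: smoothM.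
Qed.

Lemma pderiv_tapply n (c : tensor n) U G X x w m : open U -> U x ->
  smooth_conn U G -> (forall i, smooth_vf U (X i)) ->
  pderiv m (fun y => tapply c G X y 0 w) x =
  \sum_p contr (fun rho => jeval (cjet G x) (c rho w))
    (upd (fun i j => X i x 0 j) p (fun j => pderiv m (fun y => X p y 0 j) x)) +
  contr (fun rho => jeval (cjet G x) (jder m (c rho w))) (fun i j => X i x 0 j).
Proof.
move=> oU Ux sG sX; rewrite /tapply; under eq_fun do rewrite mxE.
have dX i j : differentiable (fun y => X i y 0 j) x by exact: smooth_diff (sX i j) Ux.
have dG e : differentiable (fun y => jeval (cjet G y) e) x.
  exact: smooth_diff (jeval_smooth e oU sG) Ux.
rewrite pderiv_sum; last first.
  by move=> rho; apply: differentiable_mul => //; exact: differentiable_big_prod.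
rewrite exchange_big -big_split; apply: eq_bigr => rho _ /=.
rewrite pderivM//; last exact: differentiable_big_prod.
rewrite (pderiv_jeval _ _ oU sG Ux) pderiv_prod//; congr (_ + _).
rewrite big_distrl; apply: eq_bigr => p _ /=; congr (_ * _).
by apply: eq_bigr => i _; rewrite /upd; case: eqP => // ->.
Qed.

Lemma contr_ext n (A : {ffun 'I_n -> 'I_d} -> R) v v' :
  v =2 v' -> contr A v = contr A v'.
Proof.
move=> vv'; apply: eq_bigr => rho _; congr (_ * _).
by apply: eq_bigr => i _; exact: vv'.
Qed.

(** Leibniz rule: the terms that differentiate the arguments cancel. Covariant differentiation is
    thereby expressed through [nabla] and [tapply], and its naturality can be read off without a
    transformation law for components. *)
Lemma nabla_tensorE n (c : tensor n) U G (X : 'I_n.+1 -> vf) x :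
  open U -> U x -> smooth_conn U G -> (forall i, smooth_vf U (X i)) ->
  let X' q := X (lift ord0 q) in
  tapply (nabla_tensor c) G X x =
  nabla G (X ord0) (tapply c G X') x -
  \sum_p tapply c G (upd X' p (nabla G (X ord0) (X' p))) x.
Proof.
move=> oU Ux sG sX X'; apply/rowP => w; rewrite !mxE summxE.
(* In slot [p] the derivative of the argument is separated from its Christoffel term, and the latter
   is moved from the vector onto the tensor. *)
under [X in _ = _ - X]eq_bigr => p _.
  rewrite mxE (@contr_ext _ _ _ (upd (fun i j => X' i x 0 j) p (fun j =>
    \sum_m X ord0 x 0 m * (pderiv m (fun y => X' p y 0 j) x +
                          \sum_l G x j m l * X' p x 0 l)))); last first.
    by move=> i j; rewrite /upd; case: eqP => // _; rewrite mxE.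
  rewrite contr_slot_sum.
  under eq_bigr => m _ do rewrite contr_slotD (contr_slot_mx _ _ _ (fun j l => G x j m l)).
  over.
rewrite exchange_big /= [LHS]sum_fcons -sumrB; apply: eq_bigr => m _.
rewrite -big_distrr -mulrBr /=.
under eq_bigr => rho _.
  rewrite big_ord_recl fcons0 -mulrA.
  under [\prod_(i < n) _]eq_bigr => i _ do rewrite fconsS.
  over.
rewrite -big_distrr; congr (_ * _) => /=.
rewrite (pderiv_tapply _ _ _ oU Ux sG); last by move=> q; exact: sX.
rewrite [X in _ = _ - X]big_split /=.
under eq_bigr => rho _.
  rewrite ftail_fcons mulrDr mulrDr mulN1r mulrN jeval_sum jeval_sum.
  over.
rewrite !big_split /= sumrN.
(* [p] stands for the derivatives of the arguments, [q] for the derivative of the tensor, [r] and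
   [s] for the Christoffel terms of the upper and of the lower indices. *)
have shuffle (p q r s : R) : p + q + r - (p + s) = q + (r - s) by ring.
rewrite shuffle; congr (_ + (_ - _)).
  under [RHS]eq_bigr => l _ do rewrite mxE big_distrr.
  rewrite exchange_big; apply: eq_bigr => rho _.
  rewrite big_distrr big_enum; apply: eq_bigr => l _ /=.
  by rewrite mulrCA.
rewrite exchange_big; apply: eq_bigr => rho _.
rewrite -big_distrr /= big_enum; congr (_ * _); apply: eq_bigr => p _.
by rewrite jeval_sum big_enum.
Qed.

End CovariantDerivative.

(** * Naturality *)

Section Naturality.
Variables (R : realType) (d : nat).
Local Notation vf := ('rV[R]_d -> 'rV[R]_d).
Implicit Types (G : christoffel R d) (U W : set 'rV[R]_d) (x : 'rV[R]_d).
Implicit Types (X Y Z : vf).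

(** The local situation common to transition maps between charts and to local diffeomorphisms read
    in charts. *)
Record change (phi : vf) W W' G G' : Prop := Change {
  change_open : open W;
  change_open' : open W';
  change_sub : forall x, W x -> W' (phi x);
  change_smooth : smooth_vf W phi;
  change_conn : smooth_conn W G;
  change_conn' : smooth_conn W' G';
  change_transform : forall x, W x -> conn_transform phi G G' x }.

Definition related (phi : vf) W X X' : Prop :=
  forall x, W x -> vect_transform phi X X' x.

Lemma related_comb phi W X X' Y Y' (a b : R) :
  related phi W X X' -> related phi W Y Y' ->
  related phi W (fun x => a *: X x + b *: Y x) (fun x => a *: X' x + b *: Y' x).
Proof.
move=> rX rY x Wx w; rewrite !mxE rX// rY// !big_distrr -big_split /=.
by apply: eq_bigr => k _; rewrite !mxE; ring.
Qed.

Lemma related_eq phi W W' X X' Y Y' : (forall x, W x -> W' (phi x)) ->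
  (forall x, W x -> X x = Y x) -> (forall x, W' x -> X' x = Y' x) ->
  related phi W X X' -> related phi W Y Y'.
Proof.
move=> WW' XY XY' rX x Wx w; rewrite -XY'; last exact: WW'.
by rewrite rX//; apply: eq_bigr => k _; rewrite XY.
Qed.

Lemma related0 phi W : related phi W (fun=> 0) (fun=> 0).
Proof. by move=> x _ w; rewrite !mxE big1// => k _; rewrite mxE mulr0. Qed.

Lemma related_sum phi W (I : Type) (r : seq I) (X X' : I -> vf) :
  (forall i, related phi W (X i) (X' i)) ->
  related phi W (fun x => \sum_(i <- r) X i x) (fun x => \sum_(i <- r) X' i x).
Proof.
move=> rX; elim: r => [|i r IH].
  have E (F : I -> vf) : (fun x => \sum_(i <- [::]) F i x) = fun=> 0.
    by apply/funext => x; rewrite big_nil.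
  by rewrite !E; exact: related0.
move=> x Wx w; rewrite !big_cons mxE.
have := related_comb 1 1 (rX i) IH Wx w; rewrite !mxE !mul1r => ->.
by apply: eq_bigr => k _; rewrite !mxE !mul1r.
Qed.

Lemma sum_push (J : 'I_d -> 'I_d -> R) (u t : 'I_d -> R) :
  \sum_b (\sum_i J b i * u i) * t b = \sum_i u i * \sum_b J b i * t b.
Proof.
under eq_bigr do rewrite big_distrl; rewrite exchange_big.
apply: eq_bigr => i _; rewrite big_distrr.
by apply: eq_bigr => b _ /=; ring.
Qed.

(** Differentiating $Y'\circ\phi=J\,Y$ produces second derivatives of $\phi$, which the
    inhomogeneous term of [conn_transform] absorbs. *)
Lemma nabla_related phi W W' G G' X X' Y Y' : change phi W W' G G' ->
  smooth_vf W Y -> smooth_vf W' Y' ->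
  related phi W X X' -> related phi W Y Y' ->
  related phi W (nabla G X Y) (nabla G' X' Y').
Proof.
move=> [oW oW' WW' sphi sG sG' cG] sY sY' rX rY x Wx a.
pose J a k := pderiv k (fun y => phi y 0 a) x.
have dphi b : differentiable (fun y => phi y 0 b) x by exact: smooth_diff (sphi b) Wx.
(* Both sides are the derivative along [i] of $Y'^a\circ\phi$: by the chain rule, and by the Leibniz
   rule applied to $\sum_jJ^a_jY^j$. *)
have dY i :
  \sum_b pderiv b (fun y => Y' y 0 a) (phi x) * J b i =
  \sum_j (pderiv i (pderiv j (fun y => phi y 0 a)) x * Y x 0 j +
          J a j * pderiv i (fun y => Y y 0 j) x).
  rewrite -(pderiv_comp _ dphi); last first.
    by apply: smooth_diff (sY' a) _; exact: WW'.
  rewrite (@pderiv_open _ _ W _ (fun y => \sum_j pderiv j (fun y => phi y 0 a) y * Y y 0 j))//;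
    last by move=> y Wy; exact: rY.
  rewrite pderiv_sum; last first.
    move=> j; apply: differentiable_mul.
      by apply: smooth_diff Wx; apply: smooth_pderiv.
    exact: smooth_diff (sY j) Wx.
  apply: eq_bigr => j _; rewrite pderivM//.
    by apply: smooth_diff Wx; apply: smooth_pderiv.
  exact: smooth_diff (sY j) Wx.
rewrite /nabla mxE.
under [RHS]eq_bigr do rewrite mxE big_distrr.
rewrite [RHS]exchange_big.
under [LHS]eq_bigr do rewrite rX// big_distrl.
rewrite [LHS]exchange_big; apply: eq_bigr => i _ /=.
transitivity (X x 0 i * (\sum_b pderiv b (fun y => Y' y 0 a) (phi x) * J b i +
   \sum_j Y x 0 j * \sum_b \sum_c G' (phi x) a b c * J b i * J c j)).
  under [X in _ = _ * (_ + X)]eq_bigr do rewrite big_distrr.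
  rewrite exchange_big -big_split big_distrr; apply: eq_bigr => b _ /=.
  rewrite -/(J b i) (mulrC (J b i)) -mulrA; congr (_ * _).
  rewrite mulrDr (mulrC (J b i)); congr (_ + _).
  rewrite big_distrr /=.
  under [RHS]eq_bigr do rewrite big_distrr; rewrite [RHS]exchange_big.
  apply: eq_bigr => c _; rewrite /= rY// !big_distrr.
  by apply: eq_bigr => j _; rewrite -/(J c j) /=; ring.
rewrite dY big_split /=.
transitivity (X x 0 i * (\sum_k (J a k * pderiv i (fun y => Y y 0 k) x) +
   \sum_j Y x 0 j * \sum_k J a k * G x k i j)).
  congr (_ * _); rewrite addrAC addrC; congr (_ + _); rewrite -big_split.
  by apply: eq_bigr => j _; rewrite (cG x Wx) /=; ring.
under [X in _ * (_ + X)]eq_bigr do rewrite big_distrr.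
rewrite exchange_big -big_split big_distrr; apply: eq_bigr => k _; rewrite -/(J a k) /=.
rewrite mulrCA; congr (_ * _); rewrite mulrDr; congr (_ + _).
by rewrite big_distrr; apply: eq_bigr => j _ /=; ring.
Qed.

Definition torf G X Y : vf :=
  fun x => \row_w \sum_i \sum_j X x 0 i * Y x 0 j * (G x w i j - G x w j i).

(** The inhomogeneous term of [conn_transform] is symmetric in [i] and [j], by commutation of
    partial derivatives, and drops out of the antisymmetrisation. *)
Lemma torf_related phi W W' G G' X X' Y Y' : change phi W W' G G' ->
  related phi W X X' -> related phi W Y Y' ->
  related phi W (torf G X Y) (torf G' X' Y').
Proof.
move=> [oW oW' WW' sphi sG sG' cG] rX rY x Wx a.
pose J a k := pderiv k (fun y => phi y 0 a) x.
transitivity (\sum_i \sum_j X x 0 i * Y x 0 j *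
    \sum_b \sum_c (G' (phi x) a b c - G' (phi x) a c b) * (J b i * J c j)).
  rewrite mxE; pose B b c := G' (phi x) a b c - G' (phi x) a c b.
  transitivity (\sum_b (\sum_i J b i * X x 0 i) *
      \sum_c (\sum_j J c j * Y x 0 j) * B b c).
    apply: eq_bigr => b _; rewrite -rX// big_distrr; apply: eq_bigr => c _ /=.
    by rewrite -rY// mulrA.
  rewrite sum_push; apply: eq_bigr => i _.
  under eq_bigr do rewrite sum_push big_distrr.
  rewrite exchange_big big_distrr; apply: eq_bigr => j _ /=.
  rewrite -mulrA; congr (_ * _); rewrite big_distrr; apply: eq_bigr => b _ /=.
  by rewrite !big_distrr; apply: eq_bigr => c _ /=; rewrite -/(B b c); ring.
transitivity (\sum_i \sum_j X x 0 i * Y x 0 j *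
    \sum_k J a k * (G x k i j - G x k j i)).
  apply: eq_bigr => i _; apply: eq_bigr => j _; congr (_ * _).
  under [RHS]eq_bigr do rewrite mulrBr; rewrite sumrB !(cG x Wx) /=.
  rewrite (pderivC _ _ oW (sphi a) Wx) opprD addrACA subrr add0r.
  rewrite [X in _ = _ - X]exchange_big -sumrB.
  apply: eq_bigr => b _; rewrite -sumrB; apply: eq_bigr => c _.
  by rewrite /J; ring.
rewrite /torf; under [RHS]eq_bigr do rewrite mxE big_distrr.
rewrite [RHS]exchange_big; apply: eq_bigr => i _ /=.
under [RHS]eq_bigr do rewrite big_distrr.
rewrite [RHS]exchange_big; apply: eq_bigr => j _ /=.
by rewrite big_distrr; apply: eq_bigr => k _ /=; rewrite -/(J a k); ring.
Qed.

End Naturality.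

(** * Contractions slot by slot and under permutations *)

Section SmallContractions.
Variables (R : comRingType) (d : nat).

Lemma contr_cons n (A : {ffun 'I_n.+1 -> 'I_d} -> R) v :
  contr A v =
  \sum_m v ord0 m * contr (fun rho => A (fcons m rho)) (fun i => v (lift ord0 i)).
Proof.
rewrite /contr sum_fcons; apply: eq_bigr => m _; rewrite big_distrr.
apply: eq_bigr => rho _; rewrite big_ord_recl fcons0 /= mulrA.
by under eq_bigr => i _ do rewrite fconsS.
Qed.

Lemma contr0 (A : {ffun 'I_0 -> 'I_d} -> R) v rho : contr A v = A rho.
Proof.
have E rho' : rho' = rho by apply/ffunP => -[].
rewrite /contr (bigD1 rho)//= big_ord0 mul1r big1 ?addr0// => rho'.
by rewrite (E rho') eqxx.
Qed.

Definition permf n (T : Type) (s : 'S_n) (rho : {ffun 'I_n -> T}) : {ffun 'I_n -> T} :=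
  [ffun q => rho (s q)].

Lemma permfM n (T : Type) (s t : 'S_n) (rho : {ffun 'I_n -> T}) :
  permf s (permf t rho) = permf (s * t)%g rho.
Proof. by apply/ffunP => q; rewrite !ffunE permM. Qed.

Lemma permf1 n (T : Type) (rho : {ffun 'I_n -> T}) : permf 1%g rho = rho.
Proof. by apply/ffunP => q; rewrite !ffunE perm1. Qed.

(** The sum is reindexed by [permf s] and the product by [s]. Permuting the arguments of an operator
    thus becomes permuting the indices of its components. *)
Lemma contr_perm n (A : {ffun 'I_n -> 'I_d} -> R) v (s : 'S_n) :
  contr A (fun i => v (s i)) = contr (fun rho => A (permf s rho)) v.
Proof.
have permfK (t : 'S_n) : cancel (@permf n 'I_d t) (permf t^-1%g).
  by move=> rho; rewrite permfM mulVg permf1.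
rewrite /contr (reindex_inj (can_inj (permfK s))).
apply: eq_bigr => rho _; congr (_ * _).
rewrite [RHS](reindex_inj (@perm_inj _ s)).
by apply: eq_bigr => i _; rewrite ffunE.
Qed.

End SmallContractions.

(** * Natural tensors: covariant derivatives, torsion and curvature *)

Section NaturalTensors.
Variables (R : realType) (d : nat).
Local Notation vf := ('rV[R]_d -> 'rV[R]_d).
Implicit Types (G : christoffel R d) (U W : set 'rV[R]_d) (x : 'rV[R]_d).
Implicit Types (X Y Z : vf).

(** Naturality is tested on vector fields rather than on components, so that it passes directly to
    whatever is built from [nabla] and [torf]. *)
Definition natural_tensor n (c : tensor R d n) : Prop :=
  forall phi W W' G G', change phi W W' G G' ->
  forall X X' : 'I_n -> vf,
    (forall i, smooth_vf W (X i)) -> (forall i, smooth_vf W' (X' i)) ->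
    (forall i, related phi W (X i) (X' i)) ->
    related phi W (tapply c G X) (tapply c G' X').

(** By [nabla_tensorE] the covariant derivative is a combination of [tapply c] and [nabla], which
    both preserve relatedness of fields. *)
Lemma natural_nabla n (c : tensor R d n) :
  natural_tensor c -> natural_tensor (nabla_tensor c).
Proof.
move=> nc phi W W' G G' ch X X' sX sX' rX.
have [oW oW' WW' _ sG sG' _] := ch.
pose Y H (V : 'I_n.+1 -> vf) (p : 'I_n) : 'I_n -> vf :=
  upd (fun q => V (lift ord0 q)) p (nabla H (V ord0) (V (lift ord0 p))).
apply: (@related_eq _ _ phi W W' (fun x =>
    1 *: nabla G (X ord0) (tapply c G (fun q => X (lift ord0 q))) x +
    (-1) *: \sum_p tapply c G (Y G X p) x) (fun x =>
    1 *: nabla G' (X' ord0) (tapply c G' (fun q => X' (lift ord0 q))) x +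
    (-1) *: \sum_p tapply c G' (Y G' X' p) x)) => //.
- by move=> x Wx; rewrite scale1r scaleN1r (nabla_tensorE _ oW Wx sG).
- by move=> x Wx; rewrite scale1r scaleN1r (nabla_tensorE _ oW' Wx sG').
apply: related_comb.
  apply: (nabla_related ch) => //; [exact: tapply_smooth..|].
  exact: (nc _ _ _ _ _ ch).
apply: related_sum => p; apply: (nc _ _ _ _ _ ch); rewrite /Y /upd => q.
- by case: eqP => // _; apply: nabla_smooth.
- by case: eqP => // _; apply: nabla_smooth.
- by case: eqP => // _; apply: (nabla_related ch).
Qed.

Lemma natural_perm n (c : tensor R d n) (s : 'S_n) :
  natural_tensor c -> natural_tensor (fun rho => c (permf s rho)).
Proof.
move=> nc phi W W' G G' ch X X' sX sX' rX.
have E H (Y : 'I_n -> vf) : tapply (fun rho => c (permf s rho)) H Y =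
    tapply c H (fun i => Y (s i)).
  apply/funext => x; apply/rowP => w; rewrite !mxE.
  by rewrite (contr_perm _ (fun i j => Y i x 0 j)).
by rewrite !E; apply: (nc _ _ _ _ _ ch).
Qed.

Lemma natural_sum n (I : Type) (r : seq I) (a : I -> R) (c : I -> tensor R d n) :
  (forall i, natural_tensor (c i)) ->
  natural_tensor (fun rho w => jsum r (fun i => JScale (a i) (c i rho w))).
Proof.
move=> nc phi W W' G G' ch X X' sX sX' rX.
have [oW oW' WW' _ sG sG' _] := ch.
(* The vanishing summand gives each term the binary shape of [related_comb]. *)
have E H (Y : 'I_n -> vf) :
    (fun x => \sum_(i <- r) (a i *: tapply (c i) H Y x + 0 *: 0)) =
    tapply (fun rho w => jsum r (fun i => JScale (a i) (c i rho w))) H Y.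
  apply/funext => x; apply/rowP => w; rewrite !mxE summxE /contr.
  under [RHS]eq_bigr => rho _ do rewrite jeval_sum big_distrr.
  rewrite exchange_big; apply: eq_bigr => i _; rewrite !mxE mulr0 addr0 big_distrr.
  by apply: eq_bigr => rho _; rewrite /= mulrCA.
rewrite -!E; apply: related_sum => i.
by apply: (@related_comb _ _ phi W _ _ (fun=> 0) (fun=> 0));
  [exact: (nc i _ _ _ _ _ ch)|exact: related0].
Qed.

Local Notation o0 := (ord0 : 'I__.+1).
Local Notation o1 := (lift o0 o0).
Local Notation o2 := (lift o0 (lift o0 o0)).

Definition torsion : tensor R d 2 := fun rho w =>
  JAdd (JVar R [::] w (rho o0) (rho o1))
       (JScale (-1) (JVar R [::] w (rho o1) (rho o0))).

(** Components of $R(\partial_i,\partial_j)\partial_k$; the first-order terms form the left argument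
    of the outer [JAdd]. *)
Definition curvature : tensor R d 3 := fun rho w =>
  let i := rho o0 in let j := rho o1 in let k := rho o2 in
  JAdd (JAdd (JVar R [:: i] w j k) (JScale (-1) (JVar R [:: j] w i k)))
    (jsum (enum 'I_d) (fun l =>
       JAdd (JMul (JVar R [::] w i l) (JVar R [::] l j k))
            (JScale (-1) (JMul (JVar R [::] w j l) (JVar R [::] l i k))))).

Lemma natural_torsion : natural_tensor torsion.
Proof.
move=> phi W W' G G' ch X X' sX sX' rX.
have E H (Y : 'I_2 -> vf) : torf H (Y o0) (Y o1) = tapply torsion H Y.
  apply/funext => x; apply/rowP => w; rewrite !mxE contr_cons.
  apply: eq_bigr => i _; rewrite contr_cons big_distrr; apply: eq_bigr => j _.
  rewrite (contr0 _ _ [ffun=> i]) /= fcons0 !fconsS fcons0.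
  by rewrite /cjet /= mulN1r mulrA.
by rewrite -!E; apply: (torf_related ch).
Qed.

(** The Lie bracket as $\nabla_XY-\nabla_YX-T(X,Y)$: in this form its naturality follows from that
    of [nabla] and [torf]. *)
Definition bracket G X Y : vf := fun x =>
  1 *: (1 *: nabla G X Y x + (-1) *: nabla G Y X x) + (-1) *: torf G X Y x.

Lemma bracketE G X Y x n :
  bracket G X Y x 0 n = \sum_m (X x 0 m * pderiv m (fun y => Y y 0 n) x -
                                Y x 0 m * pderiv m (fun y => X y 0 n) x).
Proof.
rewrite !mxE !mul1r !mulN1r.
have -> : \sum_i \sum_j X x 0 i * Y x 0 j * (G x n i j - G x n j i) =
    \sum_m X x 0 m * (\sum_l G x n m l * Y x 0 l) -
    \sum_m Y x 0 m * (\sum_l G x n m l * X x 0 l).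
  under [X in _ = X - _]eq_bigr do rewrite big_distrr.
  under [X in _ = _ - X]eq_bigr do rewrite big_distrr.
  rewrite [X in _ = _ - X]exchange_big -sumrB; apply: eq_bigr => i _.
  by rewrite -sumrB; apply: eq_bigr => j _ /=; ring.
under [X in X - _ - _]eq_bigr do rewrite mulrDr.
under [X in _ - X - _]eq_bigr do rewrite mulrDr.
rewrite [RHS]sumrB !big_split /=; ring.
Qed.

(** Sorted for antisymmetrisation in [X] and [Y]: the first sum yields the derivative along the
    bracket, the second derivatives of [Z] and the mixed terms are symmetric in [m] and [n], and the
    rest is the curvature. *)
Lemma nabla_nabla U G X Y Z x w : open U -> U x -> smooth_conn U G ->
  smooth_vf U Y -> smooth_vf U Z ->
  nabla G X (nabla G Y Z) x 0 w =
  \sum_n (\sum_m X x 0 m * pderiv m (fun y => Y y 0 n) x) *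
    (pderiv n (fun y => Z y 0 w) x + \sum_k G x w n k * Z x 0 k) +
  \sum_m \sum_n X x 0 m * Y x 0 n *
    (pderiv m (pderiv n (fun y => Z y 0 w)) x +
     \sum_k (G x w n k * pderiv m (fun y => Z y 0 k) x +
             G x w m k * pderiv n (fun y => Z y 0 k) x) +
     \sum_k Z x 0 k * (pderiv m (fun y => G y w n k) x +
                       \sum_l G x w m l * G x l n k)).
Proof.
move=> oU Ux sG sY sZ; rewrite mxE.
have dY n : differentiable (fun y => Y y 0 n) x by exact: smooth_diff (sY n) Ux.
have dZ n : differentiable (fun y => Z y 0 n) x by exact: smooth_diff (sZ n) Ux.
have dpZ n k : differentiable (pderiv n (fun y => Z y 0 k)) x.
  by apply: smooth_diff Ux; apply: smooth_pderiv.
have dG l m n : differentiable (fun y => G y l m n) x by exact: smooth_diff (sG l m n) Ux.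
have dE n : differentiable (fun y => pderiv n (fun y => Z y 0 w) y +
    \sum_k G y w n k * Z y 0 k) x.
  apply: differentiable_add => //; apply: differentiable_big_sum => k.
  exact: differentiable_mul.
have E m : pderiv m (fun y => nabla G Y Z y 0 w) x = \sum_n
    (pderiv m (fun y => Y y 0 n) x *
      (pderiv n (fun y => Z y 0 w) x + \sum_k G x w n k * Z x 0 k) +
     Y x 0 n * (pderiv m (pderiv n (fun y => Z y 0 w)) x +
       \sum_k (pderiv m (fun y => G y w n k) x * Z x 0 k +
               G x w n k * pderiv m (fun y => Z y 0 k) x))).
  rewrite /nabla; under eq_fun do rewrite mxE.
  rewrite pderiv_sum; last by move=> n; exact: differentiable_mul.
  apply: eq_bigr => n _; rewrite pderivM// pderivD//; last first.
    by apply: differentiable_big_sum => k; exact: differentiable_mul.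
  rewrite pderiv_sum; last by move=> k; exact: differentiable_mul.
  by under [X in _ + _ * (_ + X)]eq_bigr => k _ do rewrite pderivM//.
under [X in _ = X + _]eq_bigr do rewrite big_distrl.
rewrite [X in _ = X + _]exchange_big -big_split; apply: eq_bigr => m _ /=.
rewrite E /nabla.
under [X in _ * (_ + X)]eq_bigr do rewrite mxE big_distrr.
rewrite exchange_big -big_split big_distrr -big_split /=.
apply: eq_bigr => n _.
have -> : \sum_l G x w m l * (Y x 0 n * (pderiv n (fun y => Z y 0 l) x +
      \sum_k G x l n k * Z x 0 k)) =
    Y x 0 n * (\sum_k G x w m k * pderiv n (fun y => Z y 0 k) x +
      \sum_k Z x 0 k * \sum_l G x w m l * G x l n k).
  under [X in _ = _ * (_ + X)]eq_bigr do rewrite big_distrr.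
  rewrite [X in _ = _ * (_ + X)]exchange_big -big_split big_distrr.
  apply: eq_bigr => l _ /=; rewrite mulrCA mulrDr; congr (_ * (_ + _)).
  by rewrite big_distrr; apply: eq_bigr => k _ /=; ring.
under [X in _ = _ + _ * (_ + X)]eq_bigr do rewrite mulrDr.
rewrite !big_split /=.
under [X in _ = _ + _ * (_ + (X + _))]eq_bigr do rewrite mulrC.
ring.
Qed.

(** The right hand side of $R(X,Y)Z=\nabla_X\nabla_YZ-\nabla_Y\nabla_XZ-\nabla_{[X,Y]}Z$ is built
    from natural operations. *)
Lemma natural_curvature : natural_tensor curvature.
Proof.
move=> phi W W' G G' ch X X' sX sX' rX.
have [oW oW' WW' _ sG sG' _] := ch.
pose K H (Y : 'I_3 -> vf) x := 1 *: (1 *: nabla H (Y o0) (nabla H (Y o1) (Y o2)) x +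
    (-1) *: nabla H (Y o1) (nabla H (Y o0) (Y o2)) x) +
  (-1) *: nabla H (bracket H (Y o0) (Y o1)) (Y o2) x.
have E U H (Y : 'I_3 -> vf) x : open U -> smooth_conn U H ->
    (forall i, smooth_vf U (Y i)) -> U x -> K H Y x = tapply curvature H Y x.
  move=> oU sH sY Ux; apply/rowP => w.
  rewrite [LHS]mxE [X in X + _]mxE [X in _ + X]mxE [X in 1 * X]mxE !mul1r !mulN1r.
  rewrite [X in X + _ - _]mxE [X in _ + X - _]mxE mul1r mulN1r.
  rewrite !(nabla_nabla _ _ oU Ux)//.
  have -> : nabla H (bracket H (Y o0) (Y o1)) (Y o2) x 0 w =
      \sum_n (\sum_m Y o0 x 0 m * pderiv m (fun y => Y o1 y 0 n) x) *
    (pderiv n (fun y => Y o2 y 0 w) x + \sum_k H x w n k * Y o2 x 0 k) -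
      \sum_n (\sum_m Y o1 x 0 m * pderiv m (fun y => Y o0 y 0 n) x) *
    (pderiv n (fun y => Y o2 y 0 w) x + \sum_k H x w n k * Y o2 x 0 k).
    rewrite mxE -sumrB; apply: eq_bigr => n _.
    by rewrite bracketE sumrB mulrBl.
  (* [p] and [r] are the parts of the two second covariant derivatives in which the inner direction
     field is differentiated; the bracket term cancels them. *)
  have shuffle (p q r s : R) : p + q - (r + s) - (p - r) = q - s by ring.
  rewrite shuffle [X in _ - X]exchange_big -sumrB mxE contr_cons.
  apply: eq_bigr => m _; rewrite -sumrB contr_cons big_distrr.
  apply: eq_bigr => n _; rewrite contr_cons /=.
  rewrite (mulrC (Y o1 x 0 n)) -mulrBr -mulrA; congr (_ * (_ * _)).
  rewrite (pderivC _ _ oU (sY o2 w) Ux).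
  under [X in _ - (_ + X + _)]eq_bigr do rewrite addrC.
  have shuffle' (p q r : R) : p + q - (p + r) = q - r by ring.
  rewrite shuffle' -sumrB.
  apply: eq_bigr => k _; rewrite -mulrBr; congr (_ * _).
  rewrite (contr0 _ _ [ffun=> m]) /= !fcons0 !fconsS !fcons0.
  rewrite jeval_sum big_enum /= /cjet /= mulN1r.
  under [X in _ = _ + X]eq_bigr do rewrite mulN1r.
  by rewrite sumrB; ring.
apply: (@related_eq _ _ phi W W' (K G X) (K G' X')) => //.
- by move=> x Wx; exact: (E W).
- by move=> x Wx; exact: (E W').
apply: related_comb.
  by apply: related_comb; apply: (nabla_related ch) => //;
    by [apply: nabla_smooth|apply: (nabla_related ch)].
apply: (nabla_related ch) => //.
apply: related_comb; first by apply: related_comb; apply: (nabla_related ch).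
by apply: (torf_related ch).
Qed.

End NaturalTensors.

(** * Leading terms *)

Section LeadingParts.
Variables (R : realType) (d : nat).
Implicit Types (G : christoffel R d) (U : set 'rV[R]_d) (x : 'rV[R]_d).

(* The coefficient of the symbol $e_{\mathrm{id}}$; that of $e_s$ is [gam \o permf s]. *)
Definition gam m : tensor R d m.+2 := fun rho w =>
  JVar R [seq rho (inord i) | i <- iota 0 m] w (rho (inord m)) (rho (inord m.+1)).

Definition gam_diff m (t : 'S_m.+2) : tensor R d m.+2 := fun rho w =>
  JAdd (gam rho w) (JScale (-1) (gam (permf t rho) w)).

(** Equality at jets of smooth connections only: the variables are indexed by sequences, so
    arbitrary values of them do not satisfy the symmetry of partial derivatives. *)
Definition smooth_eq n (c e : tensor R d n) : Prop :=
  forall U G x, open U -> smooth_conn U G -> U x ->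
  forall rho w, jeval (cjet G x) (c rho w) = jeval (cjet G x) (e rho w).

(** The syntactic bound on [c] makes it a function of a finite jet; the splitting into the top part
    [e] and the lower part [low] holds up to [smooth_eq]. *)
Definition leads m n (c e : tensor R d n) : Prop :=
  [/\ natural_tensor c, (forall rho w, jorder_lt m.+1 (c rho w)) &
      exists2 low : tensor R d n, (forall rho w, jorder_lt m (low rho w)) &
        smooth_eq c (fun rho w => JAdd (e rho w) (low rho w))].

Lemma leads_eq m n (c e e' : tensor R d n) :
  smooth_eq e e' -> leads m c e -> leads m c e'.
Proof.
move=> ee' [nc oc [low olow E]]; split => //; exists low => // U G x oU sG Ux rho w.
by rewrite (E U)//= (ee' U).
Qed.

(** Only the partial derivative raises the order; the Christoffel terms stay within the order bound
    of [c] and join the lower order part. *)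
Lemma leads_nabla m n (c e : tensor R d n) : leads m c e ->
  leads m.+1 (nabla_tensor c)
    (fun (rho : {ffun 'I_n.+1 -> 'I_d}) w => jder (rho ord0) (e (ftail rho) w)).
Proof.
move=> [nc oc [low olow E]].
(* [rest] extracts these Christoffel terms; the [JZero] branch never occurs. *)
pose rest rho w := if nabla_tensor c rho w is JAdd _ f then f else JZero R d.
have orest rho w : jorder_lt m.+1 (rest rho w).
  rewrite /rest /=; apply/andP; split; first by apply: jorder_lt_sum => l /=.
  by apply: jorder_lt_sum => p; apply: jorder_lt_sum => l /=.
split; first exact: natural_nabla.
  move=> rho w; apply/andP; split; first exact: jorder_lt_jder.
  exact: jorder_ltW (leqnSn _) (orest rho w).
exists (fun (rho : {ffun 'I_n.+1 -> 'I_d}) w =>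
    JAdd (jder (rho ord0) (low (ftail rho) w)) (rest rho w)).
  by move=> rho w; apply/andP; split; [exact: jorder_lt_jder|exact: orest].
move=> U G x oU sG Ux rho w; set i := rho ord0; set rho' := ftail rho.
have D : jeval (cjet G x) (jder i (c rho' w)) =
    jeval (cjet G x) (jder i (e rho' w)) + jeval (cjet G x) (jder i (low rho' w)).
  have dj f : differentiable (fun y => jeval (cjet G y) f) x.
    exact: smooth_diff (jeval_smooth f oU sG) Ux.
  rewrite -!(pderiv_jeval _ _ oU sG Ux) -pderivD//.
  by apply: (pderiv_open _ oU) => // y Uy; rewrite (E U).
rewrite [LHS](_ : _ = jeval (cjet G x) (jder i (c rho' w)) +
  jeval (cjet G x) (rest rho w))// D -addrA.
by [].
Qed.

Lemma leads_sum m n (I : Type) (r : seq I) (a : I -> R) (c e : I -> tensor R d n) :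
  (forall i, leads m (c i) (e i)) ->
  leads m (fun rho w => jsum r (fun i => JScale (a i) (c i rho w)))
          (fun rho w => jsum r (fun i => JScale (a i) (e i rho w))).
Proof.
move=> H; split.
- by apply: natural_sum => i; case: (H i).
- by move=> rho w; apply: jorder_lt_sum => i; case: (H i) => _ oc _; exact: oc.
- have /boolp.choice[low olow] : forall i, exists low : tensor R d n,
      (forall rho w, jorder_lt m (low rho w)) /\
      smooth_eq (c i) (fun rho w => JAdd (e i rho w) (low rho w)).
    by move=> i; have [_ _ [low ol El]] := H i; exists low.
  exists (fun rho w => jsum r (fun i => JScale (a i) (low i rho w))).
    by move=> rho w; apply: jorder_lt_sum => i; apply: (olow i).1.
  move=> U G x oU sG Ux rho w /=; rewrite !jeval_sum -big_split.
  by apply: eq_bigr => i _ /=; rewrite ((olow i).2 U) //= mulrDr.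
Qed.

Lemma leads_perm m n (c e : tensor R d n) (s : 'S_n) : leads m c e ->
  leads m (fun rho => c (permf s rho)) (fun rho => e (permf s rho)).
Proof.
move=> [nc oc [low olow E]]; split => //; first exact: natural_perm.
by exists (fun rho => low (permf s rho)) => // U G x oU sG Ux rho w; exact: (E U).
Qed.

Lemma gam_ftail m (rho : {ffun 'I_m.+3 -> 'I_d}) w :
  jder (rho ord0) (@gam m (ftail rho) w) = gam rho w.
Proof.
have E i : (i < m.+2)%N -> ftail rho (inord i) = rho (inord i.+1).
  move=> im; rewrite ffunE; congr (rho _); apply: val_inj.
  by rewrite /= /bump /= !inordK.
rewrite /gam /= !E//; congr JVar; congr (_ :: _).
  by congr (rho _); apply: val_inj; rewrite /= inordK.
rewrite -[1%N]/(1 + 0)%N iotaDl -map_comp; apply/eq_in_map => i.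
by rewrite mem_iota add0n /= => im; rewrite E// ltnW// ltnW.
Qed.

Lemma permf_ftail n (t : 'S_n) (rho : {ffun 'I_n.+1 -> 'I_d}) :
  permf t (ftail rho) = ftail (permf (lift_perm ord0 ord0 t) rho).
Proof. by apply/ffunP => q; rewrite !ffunE lift_perm_lift. Qed.

Lemma gam_diff_ftail m (t : 'S_m.+2) (rho : {ffun 'I_m.+3 -> 'I_d}) w :
  jder (rho ord0) (gam_diff t (ftail rho) w) = gam_diff (lift_perm ord0 ord0 t) rho w.
Proof.
rewrite {2}/gam_diff -gam_ftail -(gam_ftail (permf _ rho)) -permf_ftail.
by rewrite ffunE lift_perm_id.
Qed.

Lemma lift_perm_tperm n (i j : 'I_n) :
  lift_perm ord0 ord0 (tperm i j) = tperm (lift ord0 i) (lift ord0 j).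
Proof.
apply/permP => q; case: (unliftP ord0 q) => [q' ->|->].
  rewrite lift_perm_lift; case: (tpermP i j q') => [->|->|/eqP iq /eqP jq].
  - by rewrite tpermL.
  - by rewrite tpermR.
  - by rewrite tpermD// (inj_eq lift_inj) eq_sym.
by rewrite lift_perm_id tpermD.
Qed.

Lemma lift0_inord n i : (i <= n)%N -> lift ord0 (inord i : 'I_n.+1) = inord i.+1.
Proof. by move=> ni; apply: val_inj; rewrite /= /bump /= !inordK. Qed.

Definition swappable m (t : 'S_m.+2) : Prop := exists c, leads m c (gam_diff t).

(** Covariant differentiation adds a slot in front, which the lifted permutation fixes. *)
Lemma swappable_lift m (t : 'S_m.+2) :
  swappable t -> swappable (lift_perm ord0 ord0 t).
Proof.
move=> [c lc]; exists (nabla_tensor c); apply: leads_eq (leads_nabla lc).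
by move=> U G x oU sG Ux rho w; rewrite gam_diff_ftail.
Qed.

(** Iterated covariant derivatives of the torsion; the two positions are those of the lower indices
    of $\Gamma$. *)
Lemma swappable_torsion m : swappable (tperm (inord m : 'I_m.+2) (inord m.+1)).
Proof.
elim: m => [|m IH]; last first.
  by have := swappable_lift IH; rewrite lift_perm_tperm !lift0_inord.
exists (@torsion R d); split; [exact: natural_torsion|by []|].
exists (fun _ _ => JZero R d) => // U G x oU sG Ux rho w /=.
have E0 : inord 0 = ord0 :> 'I_2 by apply: val_inj; rewrite /= inordK.
have E1 : inord 1 = lift ord0 ord0 :> 'I_2 by apply: val_inj; rewrite /= inordK.
by rewrite !ffunE !E0 !E1 tpermL tpermR addr0.
Qed.

(** Iterated covariant derivatives of the curvature; the two positions are those of the last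
    derivative and of the first lower index of $\Gamma$. *)
Lemma swappable_curvature m : swappable (tperm (inord m : 'I_m.+3) (inord m.+1)).
Proof.
elim: m => [|m IH]; last first.
  by have := swappable_lift IH; rewrite lift_perm_tperm !lift0_inord// ltnW.
exists (@curvature R d); split; [exact: natural_curvature| |].
  by move=> rho w /=; rewrite jorder_lt_sum.
exists (fun rho w => if curvature R rho w is JAdd _ f then f else JZero R d).
  by move=> rho w /=; rewrite jorder_lt_sum.
move=> U G x oU sG Ux rho w /=; congr (_ + _).
have E0 : inord 0 = ord0 :> 'I_3 by apply: val_inj; rewrite /= inordK.
have E1 : inord 1 = lift ord0 ord0 :> 'I_3 by apply: val_inj; rewrite /= inordK.
have E2 : inord 2 = lift ord0 (lift ord0 ord0) :> 'I_3.
  by apply: val_inj; rewrite /= inordK.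
by rewrite !ffunE !E0 !E1 !E2 tpermL tpermR tpermD.
Qed.

(** Telescoping: the difference for [s * t] is [gam_diff t] plus [gam_diff s] taken at
    [permf t rho]. *)
Lemma swappableM m (s t : 'S_m.+2) :
  swappable s -> swappable t -> swappable (s * t)%g.
Proof.
move=> [c lc] [e le].
pose C (b : bool) := if b then fun rho => c (permf t rho) else e.
pose L (b : bool) := if b then fun rho => gam_diff s (permf t rho) else gam_diff t.
have lCL b : leads m (C b) (L b) by case: b => //; exact: leads_perm.
eexists; apply: leads_eq (leads_sum [:: true; false] (fun=> 1) lCL).
move=> U G x oU sG Ux rho w; rewrite jeval_sum !big_cons big_nil /= permfM.
ring.
Qed.

(** Adjacent exchanges bring the head of [s] to the front of [s']; the induction covers all points
    of [U] because the outer derivative sees a neighbourhood. *)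
Lemma pderivs_perm U (f : 'rV[R]_d -> R) s s' x : open U -> smooth_on U f -> U x ->
  perm_eq s s' -> pderivs s f x = pderivs s' f x.
Proof.
move=> oU sf.
have front i s1 s2 y : U y -> pderivs (s1 ++ i :: s2) f y = pderivs (i :: s1 ++ s2) f y.
  elim: s1 y => //= j s1 IH y Uy.
  rewrite (pderiv_open _ oU IH Uy) /= (pderivC _ _ oU _ Uy)//.
  exact: smooth_on_pderivs.
elim: s s' x => [|i s IH] s' x Ux ss'.
  by rewrite perm_sym in ss'; rewrite (perm_nilP ss').
have is' : i \in s' by rewrite -(perm_mem ss') mem_head.
move: ss'; case/splitPr: is' => s1 s2.
rewrite perm_sym -cat1s perm_catCA perm_cons perm_sym => ss'.
rewrite front//=; apply: (pderiv_open _ oU) => // y Uy.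
exact: IH.
Qed.

(** The bound stays [m.+2 - 2] so that this is the very subgroup used in [e_symbol]. *)
Definition head_perms m : {set 'S_m.+2} :=
  Sym [set i : 'I_m.+2 | (i < m.+2 - 2)%N]%SET.

(** Such an [h] reorders the directions of differentiation and fixes the two lower indices of
    $\Gamma$, so the symmetry of partial derivatives applies. *)
Lemma gam_head_perm m (h : 'S_m.+2) : h \in head_perms m ->
  smooth_eq (fun rho => gam (permf h rho)) (@gam m).
Proof.
rewrite /head_perms !subSS subn0 inE => ho U G x oU sG Ux rho w /=.
have hfix i : (m <= i)%N -> (i < m.+2)%N -> h (inord i) = inord i.
  by move=> mi im; apply: (out_perm ho); rewrite inE inordK// -leqNgt.
rewrite !ffunE !hfix//; apply: (pderivs_perm oU) => //.
rewrite (eq_map (g := rho \o (h \o inord))); last by move=> i /=; rewrite ffunE.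
rewrite (map_comp rho) [X in perm_eq _ X](map_comp rho); apply: perm_map.
have inj : {in iota 0 m &, injective (inord : nat -> 'I_m.+2)}.
  move=> i j; rewrite !mem_iota !add0n /= => im jm /(congr1 val) /=.
  by rewrite !inordK// ltnW// ltnW.
have memE (q : 'I_m.+2) : (q \in [seq inord i | i <- iota 0 m]) = (q < m)%N.
  apply/mapP/idP => [[i]|qm].
    by rewrite mem_iota add0n /= => im ->; rewrite inordK// ltnW// ltnW.
  by exists (val q); rewrite ?mem_iota ?add0n ?inord_val.
apply: uniq_perm.
- by rewrite map_comp (map_inj_uniq perm_inj) map_inj_in_uniq ?iota_uniq.
- by rewrite map_inj_in_uniq ?iota_uniq.
move=> q; rewrite (map_comp h) memE -{1}[q](permKV h) (mem_map perm_inj) memE.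
by have := perm_closed ((h^-1)%g q) ho; rewrite !inE permKV.
Qed.

Lemma swappable_head_perm m (h : 'S_m.+2) : h \in head_perms m -> swappable h.
Proof.
move=> hH; exists (fun _ _ => JZero R d); split => //.
  move=> phi W W' G G' ch X X' sX sX' rX.
  have E H Y : tapply (fun (_ : {ffun 'I_m.+2 -> 'I_d}) (_ : 'I_d) => JZero R d) H Y = fun=> 0.
    apply/funext => x; apply/rowP => w; rewrite !mxE /contr big1// => rho _.
    by rewrite mulr0.
  by rewrite !E; exact: related0.
exists (fun _ _ => JZero R d) => // U G x oU sG Ux rho w.
by have := gam_head_perm hH oU sG Ux rho w; rewrite /= => ->; ring.
Qed.

(** Swappable permutations contain the identity and are closed under products, hence form a subgroup
    of a finite group. It suffices that it contains the transpositions of position [m] with all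
    others. *)
Lemma swappable_all m (t : 'S_m.+2) : swappable t.
Proof.
pose S : {set 'S_m.+2} := [set t | `[< swappable t >]]%SET.
have gS : group_set S.
  apply/group_setP; split.
    by rewrite !inE; apply: swappable_head_perm; rewrite inE perm_on1.
  move=> s u; rewrite !inE => ss su; exact: swappableM.
have : t \in <<[set tperm (inord m : 'I_m.+2) y | y in 'I_m.+2]%SET>>%g.
  by rewrite gen_tperm inE.
suff /fintype.subsetP sub :
    <<[set tperm (inord m : 'I_m.+2) y | y in 'I_m.+2]%SET>>%g \subset Group gS.
  by move=> /sub; rewrite !inE.
rewrite gen_subG; apply/fintype.subsetP => _ /imsetP[y _ ->]; rewrite !inE.
(* Positions from [m] on give the identity or the torsion transposition; those below [m] are reached
   by conjugation. *)
have [ym|my] := ltnP y m; last first.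
  have [->|ny] := eqVneq y (inord m).
    by rewrite tperm1; apply: swappable_head_perm; rewrite inE perm_on1.
  rewrite (_ : y = inord m.+1); first exact: swappable_torsion.
  apply: val_inj; rewrite /= inordK//; apply/eqP; rewrite eqn_leq -ltnS ltn_ord /=.
  rewrite ltn_neqAle my andbT; apply: contra ny => /eqP my'.
  by apply/eqP/val_inj; rewrite /= inordK.
case: m t S gS y ym => // m _ _ _ y ym.
have h (k : 'I_m.+3) : (k < m.+1)%N -> (tperm y k) \in head_perms m.+1.
  move=> km; rewrite inE; apply: (fintype.subset_trans (tperm_on _ _)).
  by apply/fintype.subsetP => q; rewrite !inE !subSS subn0 => /orP[]/eqP->.
have km : ((inord m : 'I_m.+3) < m.+1)%N by rewrite inordK// ltnW// ltnW.
(* The curvature transposition conjugated by a transposition of head positions. *)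
have -> : tperm (inord m.+1) y = (tperm y (inord m) *
    (tperm (inord m) (inord m.+1) * tperm y (inord m)))%g.
  rewrite -{1}(tpermV y) -[(_ * _)%g]/(_ ^ _)%g tpermJ tpermR tpermD.
  - by rewrite tpermC.
  - apply/eqP => /(congr1 val) /=; rewrite inordK// => E; have := ym.
    by rewrite [X in (X < _)%N]E ltnn.
  - apply/eqP => /(congr1 val) /=; rewrite !inordK//; last by rewrite ltnW// ltnW.
    by move=> /eqP; rewrite ltn_eqF.
apply: swappableM; first by apply: swappable_head_perm; exact: h.
apply: swappableM; last by apply: swappable_head_perm; exact: h.
exact: swappable_curvature.
Qed.

End LeadingParts.

(** * From tensors to natural operators *)

Section CanonicalTensor.
Variables (R : realType) (d m : nat).

(* Averaging over all permutations makes the leading part equivariant, averaging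
   over [head_perms m] makes the whole operator depend only on the coset of the
   permutation of its arguments. *)
Lemma canonical_tensor : exists2 c : tensor R d m.+2,
  leads m c (fun rho w => JAdd (gam R rho w) (JScale (- #|'S_m.+2|%:R^-1)
    (jsum (enum 'S_m.+2) (fun t => gam R (permf t rho) w)))) &
  forall h v rho w, h \in head_perms m ->
    jeval v (c (permf h rho) w) = jeval v (c rho w).
Proof.
set N : R := #|'S_m.+2|%:R; pose H := head_perms m; pose K : R := #|H|%:R.
have N0 : N != 0 by rewrite pnatr_eq0 -lt0n; apply/card_gt0P; exists 1%g.
have K0 : K != 0.
  by rewrite pnatr_eq0 -lt0n; apply/card_gt0P; exists 1%g; rewrite inE perm_on1.
have /boolp.choice[c0 lc0] := @swappable_all R d m.
have lc1 := leads_sum (enum 'S_m.+2) (fun=> N^-1) lc0.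
set c1 := (fun rho : {ffun 'I_m.+2 -> 'I_d} => _) in lc1.
have lc2 := leads_sum (enum H) (fun=> K^-1) (fun g => leads_perm g lc1).
eexists; first apply: leads_eq lc2.
  move=> U G x oU sG Ux rho w.
  rewrite jeval_sum /= !jeval_sum.
  pose ga t := jeval (cjet G x) (gam R (permf t rho) w).
  have Hga g : g \in H -> ga g = jeval (cjet G x) (gam R rho w).
    by move=> gH; exact: (gam_head_perm gH oU sG Ux).
  rewrite [RHS](_ : _ = K^-1 * \sum_(g <- enum H) (ga 1%g - N^-1 * \sum_t ga t)).
    rewrite big_distrr !big_enum /=; apply: eq_bigr => g gH.
    rewrite jeval_sum big_enum /=; congr (_ * _).
    transitivity (\sum_t N^-1 * (ga g - ga (t * g)%g)).
      by apply: eq_bigr => t _; rewrite /ga -permfM /= mulN1r.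
    rewrite -big_distrr sumrB /= sumr_const mulrBr -mulr_natl mulrA mulVf// mul1r.
    rewrite (Hga _ gH) -(Hga 1%g) ?inE ?perm_on1//; congr (_ - _ * _).
    (* The sum over all permutations is invariant under right translation, so permuting the slots by
       [g] leaves the averaged part unchanged. *)
    rewrite [RHS](reindex_inj (mulIg g)).
    by [].
  rewrite [in RHS]big_enum sumr_const -mulr_natl mulrA mulVf// mul1r mulNr big_enum.
  by rewrite /ga permf1.
(* Here invariance comes from reindexing the sum over [head_perms m], so it holds for arbitrary
   values [v] of the variables. *)
move=> h v rho w hH /=; rewrite !jeval_sum !big_enum /=.
rewrite [RHS](reindex_inj (mulIg h)).
apply: eq_big => [g|g gH]; first by rewrite groupMr.
by rewrite permfM.
Qed.

End CanonicalTensor.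

Section JetFunctions.
Variables (R : realType) (d n r : nat).

(** Reads the variables of an expression off a point of the jet space; a sequence of length at least
    [r] has no coordinate there and gets the value 0. Matching on [idP] supplies the proof that
    [Ordinal] takes. *)
Definition conn_coord (u : 'rV[R]_#|jet_idx d n r|) : jval R d := fun s l mu nu =>
  match @idP (size s < r)%N with
  | ReflectT H => u 0 (enum_rank
      (inl (@Tagged _ (Ordinal H) (fun k : 'I_r => k.-tuple 'I_d) (in_tuple s), (l, mu, nu))))
  | _ => 0
  end.

Definition vf_coord (u : 'rV[R]_#|jet_idx d n r|) (i : 'I_n) (l : 'I_d) : R :=
  match @idP (0 < r)%N with
  | ReflectT H => u 0 (enum_rank
      (inr (@Tagged _ (Ordinal H) (fun k : 'I_r => k.-tuple 'I_d) [tuple], (i, l))))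
  | _ => 0
  end.

Definition tensor_jet (c : tensor R d n) : jet_function R d n r := fun u =>
  \row_w contr (fun rho => jeval (conn_coord u) (c rho w)) (vf_coord u).

Lemma tensor_jet_smooth (c : tensor R d n) : smooth_jet_function (tensor_jet c).
Proof.
move=> w; rewrite /tensor_jet; under eq_fun do rewrite mxE.
apply: smooth_sum => [|rho]; first exact: openT.
apply: smoothM; first exact: openT.
  apply: smooth_prod => [|i]; first exact: openT.
  rewrite /vf_coord; case: {-}_ / idP => [H|_]; last by apply: smooth_cst; exact: openT.
  by apply: smooth_coord; exact: openT.
elim: (c rho w) => /= [|s l mu nu|e IHe f IHf|e IHe f IHf|a e IHe].
- by apply: smooth_cst; exact: openT.
- rewrite /conn_coord; case: {-}_ / idP => [H|_]; last by apply: smooth_cst; exact: openT.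
  by apply: smooth_coord; exact: openT.
- by apply: smoothD => //; exact: openT.
- by apply: smoothM => //; exact: openT.
- by apply: smoothM => //; [exact: openT|apply: smooth_cst; exact: openT].
Qed.

Lemma tensor_jetE (c : tensor R d n) G X x :
  (forall rho w, jorder_lt r (c rho w)) ->
  tensor_jet c (jet r G X x) = tapply c G X x.
Proof.
move=> oc; apply/rowP => w; rewrite !mxE.
(* For [r = 0] the jet has no coordinates, not even the values of the fields; both sides vanish
   because an expression of order [< 0] does. This occurs for the lower order terms of operators on
   two fields. *)
have [r0|r0] := posnP r.
  rewrite /contr !big1// => rho _; rewrite jeval_order0 ?mulr0//; rewrite -r0; exact: oc.
rewrite (@contr_ext _ _ _ _ _ (fun i j => X i x 0 j)); last first.
  move=> i j; rewrite /vf_coord; case: {-}_ / idP => [H|]; last by rewrite r0.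
  by rewrite mxE enum_rankK.
apply: eq_bigr => rho _; congr (_ * _).
apply: (jeval_eq (r := r)) => // s l mu nu sr.
rewrite /conn_coord; case: {-}_ / idP => [H|]; last by rewrite sr.
by rewrite mxE enum_rankK.
Qed.

End JetFunctions.

Section TensorOperators.
Variables (R : realType) (d : nat).

Lemma overlap_open (M N : manifold R d) (f : M -> N) c c' :
  (forall p, {for p, continuous f}) ->
  open (overlap (chart_ c) (chart_ c') f).
Proof.
move=> cf; rewrite openE => x [cx dx]; apply: filterI.
  by apply: open_nbhs_nbhs; split => //; exact: cod_open.
have cfp : {for x, continuous (f \o param (chart_ c))}.
  by apply: continuous_comp; [exact: param_continuous|exact: cf].
by apply: cfp; apply: open_nbhs_nbhs; split => //; exact: dom_open.
Qed.

Lemma change_of_chart (M N : manifold R d) (f : M -> N) (G : connection M)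
    (G' : connection N) c c' :
  (forall p, {for p, continuous f}) ->
  smooth_vf (overlap (chart_ c) (chart_ c') f) (crep (chart_ c) (chart_ c') f) ->
  (forall x, overlap (chart_ c) (chart_ c') f x ->
     conn_transform (crep (chart_ c) (chart_ c') f) (G c) (G' c') x) ->
  change (crep (chart_ c) (chart_ c') f) (overlap (chart_ c) (chart_ c') f)
    (cod (chart_ c')) (G c) (G' c').
Proof.
move=> cf sf fG; split => //.
- exact: overlap_open.
- exact: cod_open.
- by move=> x [_ dx]; exact: coord_cod.
- by move=> l m n s x [cx _]; exact: ccomp_smooth.
- exact: ccomp_smooth.
Qed.

Lemma local_diffeo_continuous (M N : manifold R d) (f : M -> N) :
  local_diffeo f -> forall p, {for p, continuous f}.
Proof. by move=> df p; have [U [V [g [[_ Up] _ _ _ [[cf _] _]]]]] := df p; exact: cf. Qed.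

Lemma local_diffeo_smooth (M N : manifold R d) (f : M -> N) c c' : local_diffeo f ->
  smooth_vf (overlap (chart_ c) (chart_ c') f) (crep (chart_ c) (chart_ c') f).
Proof.
move=> df k s x ox.
have [U [V [g [[_ Up] _ _ _ [[_ sf] _]]]]] := df (param (chart_ c) x).
exact: sf.
Qed.

Variables (n : nat) (c : tensor R d n).
Hypothesis nc : natural_tensor c.

(** For [id] this makes the local components into a vector field; for a local diffeomorphism it is
    naturality of the operator. *)
Lemma related_tensor (M N : manifold R d) (f : M -> N) (G : connection M)
    (G' : connection N) (X : 'I_n -> vfield M) (X' : 'I_n -> vfield N) k k' :
  change (crep (chart_ k) (chart_ k') f) (overlap (chart_ k) (chart_ k') f)
    (cod (chart_ k')) (G k) (G' k') ->
  (forall i x, overlap (chart_ k) (chart_ k') f x ->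
     vect_transform (crep (chart_ k) (chart_ k') f) (X i k) (X' i k') x) ->
  related (crep (chart_ k) (chart_ k') f) (overlap (chart_ k) (chart_ k') f)
    (tapply c (G k) (fun i => X i k)) (tapply c (G' k') (fun i => X' i k')).
Proof.
move=> ch rX; apply: (nc ch) => //.
- by move=> i l s x [kx _]; exact: vcomp_smooth.
- by move=> i l; exact: vcomp_smooth.
Qed.

Section OnManifold.
Variables (M : manifold R d) (G : connection M) (X : 'I_n -> vfield M).

Definition tensor_comp (k : idx M) := tapply c (G k) (fun i => X i k).

Lemma tensor_comp_smooth k l :
  smooth_on (cod (chart_ k)) (fun x => tensor_comp k x 0 l).
Proof.
apply: tapply_smooth; [exact: cod_open|exact: ccomp_smooth|].
by move=> i j; exact: vcomp_smooth.
Qed.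

Lemma tensor_comp_compat k k' x : overlap (chart_ k) (chart_ k') id x ->
  vect_transform (crep (chart_ k) (chart_ k') id) (tensor_comp k) (tensor_comp k') x.
Proof.
apply: related_tensor; last by move=> i; exact: vcomp_compat.
apply: change_of_chart; [by move=> p; exact: cvg_id| |exact: ccomp_compat].
by move=> l; exact: chart_compat.
Qed.

Definition tensor_vfield := VField tensor_comp_smooth tensor_comp_compat.

End OnManifold.

Definition tensor_op : operator R d n := tensor_vfield.

Lemma tensor_op_multilinear : multilinear_op tensor_op.
Proof.
move=> M G X j a Y Y' Y'' YE k x kx; apply/rowP => w; rewrite !mxE.
have E Z : contr (fun rho => jeval (cjet (G k) x) (c rho w))
    (fun i l => ([eta X with j |-> Z] i : vfield M) k x 0 l) =
  \sum_(rho : {ffun 'I_n -> 'I_d}) Z k x 0 (rho j) *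
    ((\prod_(i | i != j) X i k x 0 (rho i)) * jeval (cjet (G k) x) (c rho w)).
  rewrite -(contr_slotE _ (fun i l => X i k x 0 l) j (fun l => Z k x 0 l)).
  by apply: contr_ext => i l; rewrite /upd /=; case: eqP.
rewrite !E big_distrr -big_split; apply: eq_bigr => rho _ /=.
by rewrite YE// !mxE; ring.
Qed.

Lemma tensor_op_natural : natural_op tensor_op.
Proof.
move=> M N f df G G' X X' rG rX k k' x ox.
apply: related_tensor (ox); last by move=> i y oy; exact: rX.
apply: change_of_chart; [exact: local_diffeo_continuous|exact: local_diffeo_smooth|].
by move=> y oy; exact: rG.
Qed.

Variable r : nat.
Hypothesis oc : forall rho w, jorder_lt r (c rho w).

Lemma tensor_op_differential : differential_op tensor_op.
Proof.
exists r, (tensor_jet c); split; first exact: tensor_jet_smooth.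
by move=> M G X k x kx; rewrite tensor_jetE.
Qed.

Definition tensor_nat_op : nat_op R d n :=
  NatOp tensor_op_multilinear tensor_op_natural tensor_op_differential.

End TensorOperators.

(** * Quasi-symmetries and the construction of the operators *)

(** A function constant on the classes extends linearly to the free module on them, so its values
    inherit every linear relation among the symbols. *)
Lemma sum_e_symbol (R : realType) (n : nat) (a : 'S_n -> 'S_n -> R)
    (P : {set 'S_n}) (Phi : 'S_n -> R) :
  (forall h g, h \in Sym [set i : 'I_n | (i < n - 2)%N]%SET -> Phi (h * g)%g = Phi g) ->
  \sum_t \sum_(s in P) a t s *: e_symbol R (s * t)%g = 0 ->
  \sum_t \sum_(s in P) a t s * Phi (s * t)%g = 0.
Proof.
set H := Sym _ => PhiH E.
(* The linear extension, computed through a representative of each class. *)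
have PhiE g : Phi g = \sum_C Phi (repr C) * e_symbol R g C.
  rewrite (bigD1 (H :* g)%g)//= big1 => [|C /negPf CE]; last first.
    by rewrite ffunE CE mulr0.
  rewrite addr0 ffunE eqxx mulr1.
  by have /rcosetP[h hH ->] := mem_repr_rcoset H g; rewrite PhiH.
under eq_bigr => t _ do under eq_bigr => s _ do rewrite PhiE big_distrr.
under eq_bigr => t _ do rewrite exchange_big.
rewrite exchange_big big1// => C _ /=.
transitivity (Phi (repr C) * (\sum_t \sum_(s in P) a t s *: e_symbol R (s * t)%g) C).
  rewrite sum_ffunE big_distrr; apply: eq_bigr => t _.
  rewrite sum_ffunE big_distrr; apply: eq_bigr => s _ /=.
  by rewrite !ffunE /GRing.scale/=; ring.
by rewrite E ffunE mulr0.
Qed.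

Theorem theoremC (R : realType) (d : nat) (k : nat -> nat)
    (alpha : forall m : nat, 'I_(k m.+2) -> 'S_m.+2 -> R) :
  (forall (m : nat) (i : 'I_(k m.+2)),
     \sum_(s in Sigma' m.+2) alpha m i s = 0) ->
  exists J : forall m : nat, 'I_(k m.+2) -> nat_op R d m.+2,
    forall (m : nat) (i : 'I_(k m.+2)),
      has_leading_term (J m i) (alpha m i) /\
      (forall sy : {ffun 'S_m.+2 -> R},
         quasi_symmetry (alpha m i) sy -> symmetry (J m i) sy).
Proof.
move=> alpha0.
suff H m i : exists D : nat_op R d m.+2, has_leading_term D (alpha m i) /\
    (forall sy, quasi_symmetry (alpha m i) sy -> symmetry D sy).
  by exists (fun m i => projT1 (cid (H m i))) => m i; case: (cid _).
have [c1 lc1 c1H] := canonical_tensor R d m.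
(* The image of the leading term under $e_s\mapsto D_s$, where $D_s$ is the canonical tensor with
   its slots permuted by [s]. *)
have [nc oc [low olow E]] :=
  leads_sum (enum (Sigma' m.+2)) (alpha m i) (fun s => leads_perm s lc1).
exists (tensor_nat_op nc oc); split.
  exists (tensor_jet low); split; first exact: tensor_jet_smooth.
  move=> M G X k0 x kx; rewrite tensor_jetE//.
  apply/rowP => w; rewrite !mxE.
  rewrite (_ : contr _ _ = contr (fun rho => jeval (cjet (G k0) x)
    (jsum (enum (Sigma' m.+2)) (fun s => JScale (alpha m i s) (gam R (permf s rho) w))))
      (fun i l => X i k0 x 0 l) +
    contr (fun rho => jeval (cjet (G k0) x) (low rho w)) (fun i l => X i k0 x 0 l)).
    congr (_ + _); rewrite /contr.
    under eq_bigr => rho _ do rewrite jeval_sum big_enum big_distrr.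
    rewrite exchange_big; apply: eq_bigr => s _ /=.
    under eq_bigr => rho _ do rewrite mulrCA.
    rewrite -big_distrr; congr (_ * _) => /=.
    rewrite -[LHS](contr_perm (fun rho => jeval (cjet (G k0) x) (gam R rho w))
      (fun i l => X i k0 x 0 l) s).
    by [].
  rewrite /contr -big_split; apply: eq_bigr => rho _; rewrite -[RHS]mulrDr; congr (_ * _).
  rewrite (E (cod (chart_ k0)) (G k0) x (@cod_open _ _ _ _) (@ccomp_smooth _ _ _ G k0) kx) /=.
  congr (_ + _); rewrite !jeval_sum !big_enum /=.
  under eq_bigr => s _ do rewrite mulrDr.
  rewrite big_split /= -[RHS]addr0; congr (_ + _).
  (* The averaged part is the same for every [s], so it enters with coefficient
     $\sum_s\alpha_s=0$. *)
  pose avg := \sum_t jeval (cjet (G k0) x) (gam R (permf t rho) w).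
  rewrite (eq_bigr (fun s => alpha m i s * (- #|'S_m.+2|%:R^-1 * avg))).
    by rewrite -big_distrl /= alpha0 mul0r.
  move=> s _; rewrite jeval_sum big_enum /avg; congr (_ * (_ * _)).
  rewrite [RHS](reindex_inj (mulIg s)).
  by apply: eq_bigr => t _ /=; rewrite permfM.
move=> sy qs M G X k0 x kx; apply/rowP => w; rewrite summxE mxE.
(* A component of the canonical operator at the arguments permuted by [g]. It is constant on the
   classes, so the relation expressing the quasi-symmetry passes to its values. *)
pose Phi (g : 'S_m.+2) := contr (fun rho => jeval (cjet (G k0) x) (c1 rho w))
  (fun i l => X (g i) k0 x 0 l).
have PhiH h g : h \in head_perms m -> Phi (h * g)%g = Phi g.
  move=> hH; transitivity (contr (fun rho => jeval (cjet (G k0) x) (c1 (permf h rho) w))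
      (fun i l => X (g i) k0 x 0 l)).
    rewrite -[RHS](contr_perm (fun rho => jeval (cjet (G k0) x) (c1 rho w))
      (fun i l => X (g i) k0 x 0 l) h).
    by apply: contr_ext => j l; rewrite permM.
  by apply: eq_bigr => rho _; rewrite c1H.
rewrite -[RHS](sum_e_symbol PhiH qs); apply: eq_bigr => t _.
rewrite !mxE /contr.
under eq_bigr => rho _ do rewrite jeval_sum big_enum big_distrr.
rewrite exchange_big big_distrr; apply: eq_bigr => s _ /=.
under eq_bigr => rho _ do rewrite mulrCA.
rewrite -big_distrr mulrA; congr (_ * _) => /=.
rewrite -[LHS](contr_perm (fun rho => jeval (cjet (G k0) x) (c1 rho w))
      (fun i l => X (t i) k0 x 0 l) s).
by apply: contr_ext => j l; rewrite permM.
Qed.
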